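(* Let $F$ be a field, let $\mathcal{L}=(L_1,\dots,L_s)$ be a tuple of pairwise disjoint finite subsets of $F\setminus\{0\}$, and let $\kappa=(k_1,\dots,k_s)$ be an $s$-tuple of positive integers. There is an integer $R_\kappa$ such that for all integers $r\ge R_\kappa$, \[ \mathrm{ex}_{F,\mathcal{L}}(r,\kappa)=\begin{cases}\binom{r+1}{\kappa} & \text{if for every } i\in[s],\ L_i=\{\ell_i\} \text{ is a singleton, and } \sum_{i=1}^s k_i\ell_i=0 \text{ in } F,\\[2pt] \mathcal{L}^\kappa\binom{r}{\kappa} & \text{otherwise.}\end{cases} \] Moreover, any matrix over $F$ of rank at most $r$ whose columns are distinct $(\mathcal{L},\kappa)$-vectors and whose number of columns equals $\mathrm{ex}_{F,\mathcal{L}}(r,\kappa)$ has exactly $r+1$ nonzero rows in the first case and exactly $r$ nonzero rows in the second case.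
   Context: A vector over $F$ is an $(\mathcal{L},\kappa)$-vector if, for each $i\in[s]$, exactly $k_i$ of its entries lie in $L_i$, and all its remaining entries are $0$. $\mathrm{ex}_{F,\mathcal{L}}(r,\kappa)$ denotes the maximum number of distinct columns of a matrix over $F$ (with any number of rows) all of whose columns are $(\mathcal{L},\kappa)$-vectors and whose rank is at most $r$. For an integer $n$ and $\kappa'=(k'_1,\dots,k'_s)\in\mathbb{Z}_{\ge0}^s$, $\binom{n}{\kappa'}$ denotes the multinomial coefficient $\binom{n}{k'_1,\dots,k'_s,\,n-\sum_i k'_i}=\frac{n!}{k'_1!\cdots k'_s!\,(n-\sum_i k'_i)!}$ (interpreted as $0$ if $\sum_i k'_i>n$), and $\mathcal{L}^{\kappa'}=\prod_{i=1}^s |L_i|^{k'_i}$.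
   Formalization: The claim on the number of nonzero rows is stated for s ≥ 1 and all L_i nonempty, since it fails otherwise (if some L_i is empty, a matrix with no columns is extremal and has no nonzero rows); R_κ is shown to depend only on κ, not on F or the L_i. *)

(* Defs.v *)
From HB Require Import structures.
From mathcomp Require Import all_boot all_order all_algebra.
From mathcomp Require Import finmap boolp.

Set Implicit Arguments.
Unset Strict Implicit.
Unset Printing Implicit Defensive.

Import GRing.Theory.

Local Open Scope ring_scope.

Section Vectors.
Variables (F : fieldType) (s : nat).
Implicit Types (L : 'I_s -> {fset F}) (kappa : 'I_s -> nat) (r : nat).

Definition LK_vector L kappa (m : nat) (v : 'cV[F]_m) : Prop :=
  (forall i, #|[set x | v x ord0 \in L i]| = kappa i) /\
  (forall x, v x ord0 = 0 \/ exists i, v x ord0 \in L i).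

Definition columns (m n : nat) (A : 'M[F]_(m, n)) : seq 'cV[F]_m :=
  [seq col j A | j : 'I_n].

Definition nb_distinct_cols (m n : nat) (A : 'M[F]_(m, n)) : nat :=
  size (undup (columns A)).

Definition nb_nonzero_rows (m n : nat) (A : 'M[F]_(m, n)) : nat :=
  #|[set i | row i A != 0]|.

Definition ex_attained L kappa r : pred nat := fun N =>
  `[< exists (m n : nat) (A : 'M[F]_(m, n)),
        [/\ forall j, LK_vector L kappa (col j A),
            (\rank A <= r)%N
          & nb_distinct_cols A = N] >].

Lemma ex_attained0 L kappa r : exists N, ex_attained L kappa r N.
Proof.
exists 0%N; apply/asboolP; exists 0%N, 0%N, 0; split.
- by case.
- by rewrite mxrank0.
- apply/eqP; rewrite -leqn0 (leq_trans (size_undup _))//.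
  by rewrite size_map -cardE card_ord.
Qed.

Definition entries L : {fset F} := (0 |` \bigcup_(i <- enum 'I_s) L i)%fset.

(* Each column is determined by its entries in \rank A independent rows, and
   all entries lie in the finite set [entries L]; hence the maximum exists. *)
Lemma ex_attained_bounded L kappa r N :
  ex_attained L kappa r N -> (N <= #|{: entries L}| ^ r)%N.
Proof.
move=> /asboolP[m [n [A [AL Ar <-]]]].
pose f := maxrankfun A.
have entA i j : A i j \in entries L.
  rewrite /entries in_fset1U; case: (AL j) => _ /(_ i); rewrite mxE.
  case=> [->|[k Lk]]; first by rewrite eqxx.
  by apply/orP; right; apply/bigfcupP; exists k; rewrite ?mem_enum.
have [B defA] : exists B, A = B *m rowsub f A.
  by apply/submxP; rewrite eq_maxrowsub.
pose h (u : {ffun 'I_(\rank A) -> entries L}) : 'cV[F]_m :=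
  B *m \col_i val (u i).
have card_u : #|{ffun 'I_(\rank A) -> entries L}| =
    (#|{: entries L}| ^ \rank A)%N by rewrite card_ffun card_ord.
apply: (@leq_trans (#|{: entries L}| ^ \rank A)%N); last first.
  have entries_gt0 : (0 < #|{: entries L}|)%N.
    apply/card_gt0P; have e0 : 0 \in entries L by rewrite in_fset1U eqxx.
    by exists [` e0]%fset.
  by rewrite leq_pexp2l.
rewrite -card_u cardE -(size_map h); apply: uniq_leq_size (undup_uniq _) _.
move=> v; rewrite mem_undup => /mapP[j _ ->].
apply/mapP; exists [ffun i => [` entA (f i) j]%fset]; first exact: mem_enum.
apply/colP=> i; rewrite mxE.
move/matrixP: defA => /(_ i j) ->; rewrite !mxE.
by apply: eq_bigr => k _; rewrite !mxE ffunE.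
Qed.

Definition exLK L kappa r : nat :=
  ex_maxn (ex_attained0 L kappa r) (@ex_attained_bounded L kappa r).

Definition zero_sum_singletons L kappa : Prop :=
  exists ell : 'I_s -> F,
    (forall i, L i = [fset ell i]%fset) /\ \sum_i ell i *+ kappa i = 0.

End Vectors.

Definition multinom (s n : nat) (kappa : 'I_s -> nat) : nat :=
  let k := (\sum_i kappa i)%N in
  if (k <= n)%N then (n`! %/ ((\prod_i (kappa i)`!) * (n - k)`!))%N else 0%N.

Definition card_pow (F : fieldType) (s : nat)
    (L : 'I_s -> {fset F}) (kappa : 'I_s -> nat) : nat :=
  (\prod_i #|` L i| ^ kappa i)%N.

(* Main.v *)
Require Import Defs.
From HB Require Import structures.
From mathcomp Require Import all_boot all_order all_algebra.
From mathcomp Require Import perm finmap boolp.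
From mathcomp Require Import zify.

Set Implicit Arguments.
Unset Strict Implicit.
Unset Printing Implicit Defensive.

Import GRing.Theory.

Local Open Scope ring_scope.

(* Put k = sum kappa_i and K = prod kappa_i!, let d be 1 in the zero-sum
   singleton case and 0 otherwise, and write f(r) for the claimed value, so that
   K f(r) is L^kappa times the falling factorial of r + d of length k.

   If an extremal matrix for r has u nonzero rows, then averaging over the rows
   gives (u - k) ex(r) <= u ex(r - 1), since the columns vanishing on a nonzero
   row span a space of smaller dimension.  As (r + d - k) f(r) = (r + d) f(r - 1),
   the equality ex(r - 1) = f(r - 1) forces u = r + d and ex(r) = f(r).  It
   remains to find one r, bounded in terms of kappa only, for which some
   extremal matrix has at most r + d nonzero rows.

   Otherwise, for every r in a long window there is a nonzero row outside a row
   basis Q, hence a linear relation y between the rows.  If some such y has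
   bounded support, no column meets this support exactly once, and
   ex(r) - ex(r - 1) = L^kappa O(r^(k - 2)); this cannot hold in the whole window,
   because f(r) <= ex(r) <= f(r) + L^kappa O(r^(k - 1)).  If not, y excludes more
   vectors supported in Q than the k (r + 1)^(k - 1) L^kappa columns that leave
   Q can compensate, except when d = 1 and y is a nonzero constant on almost all
   of Q.  But when d = 1 there are two nonzero rows outside Q, and a combination
   of the two relations has bounded support. *)

(** * Multinomial coefficients and falling factorials *)

Lemma fact_prod_dvd (s : nat) (kappa : 'I_s -> nat) :
  ((\prod_i (kappa i)`!) %| (\sum_i kappa i)`!)%N.
Proof.
elim/big_rec2: _ => [|i a b _ dvd_ba]; first by rewrite fact0.
have /bin_fact := leq_addr a (kappa i); rewrite addKn => <-.
by rewrite dvdn_mull // dvdn_mul.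
Qed.

(** This clears the division in [multinom], so that the counts below can be compared after
    multiplication by K. *)
Lemma multinom_ffact (s n : nat) (kappa : 'I_s -> nat) :
  (multinom n kappa * \prod_i (kappa i)`!)%N = n ^_ (\sum_i kappa i).
Proof.
rewrite /multinom; case: leqP => [le_kn | lt_nk]; last by rewrite ffact_small.
set K := (\prod_i _)%N; set k := (\sum_i _)%N.
have dvdK : (K %| n ^_ k)%N.
  by rewrite -bin_ffact dvdn_mull // fact_prod_dvd.
rewrite -(ffact_fact le_kn) divnMr ?fact_gt0 //; exact: divnK.
Qed.

(** * Descriptions of vectors by slots and labels *)

Section Placements.
Variables (s : nat) (kappa : 'I_s -> nat).

(* A vector of type kappa is described by an injection of the slots into the
   rows, the kappa_i slots tagged i receiving the entries from L_i.  It has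
   exactly K = prod kappa_i! descriptions, so that K times a number of vectors is
   a number of injections. *)
Definition slot : finType := {i : 'I_s & 'I_(kappa i)}.

Local Notation Slot j := (Tagged (fun i => 'I_(kappa i)) j).

Lemma card_slot : #|{: slot}| = (\sum_i kappa i)%N.
Proof.
rewrite -sum1_card -(sig_big_dep xpredT (fun _ _ => true) (fun _ _ => 1%N)).
by apply: eq_bigr => i _; rewrite sum1_card card_ord.
Qed.

Lemma card_slot_tag i : #|[set d : slot | tag d == i]| = kappa i.
Proof.
rewrite -[RHS]card_ord -(card_imset _ (@eq_from_Tagged _ (fun i => 'I_(kappa i)) i)).
apply: eq_card => d; rewrite inE; apply/eqP/imsetP => [|[j _ ->] //].
by case: d => i' j /= eq_i; case: _ / eq_i in j *; exists j.
Qed.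

(** Such an injection amounts to an independent choice, for each i, of a bijection from the slots
    tagged i onto [S i]; disjointness of the [S i] makes the combined map injective. *)
Lemma card_slot_fillings (T : finType) (S : 'I_s -> {set T}) :
    (forall i j, i != j -> [disjoint S i & S j]) ->
    (forall i, #|S i| = kappa i) ->
  #|[set p : {ffun slot -> T} |
      injectiveb p && [forall d, p d \in S (tag d)]]| =
  (\prod_i (kappa i)`!)%N.
Proof.
move=> disjS cardS.
pose X i := [set f : {ffun 'I_(kappa i) -> T} in ffun_on (mem (S i)) | injectiveb f].
have cardX i : #|X i| = (kappa i)`!.
  by rewrite card_inj_ffuns_on card_ord cardS ffactnn.
pose h (q : {dffun forall i, {ffun 'I_(kappa i) -> T}}) : {ffun slot -> T} :=
  [ffun d => q (tag d) (tagged d)].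
have h_inj : injective h.
  move=> q1 q2 /ffunP eq_h; apply/ffunP => i; apply/ffunP => j.
  by have := eq_h (Slot j); rewrite !ffunE.
rewrite -(eq_bigr _ (fun i _ => cardX i)) -cardsXn -(card_imset _ h_inj).
apply: eq_card => p; rewrite inE; apply/andP/imsetP.
- move=> [/injectiveP p_inj /forallP pS].
  exists (finfun (fun i => [ffun j => p (Slot j)])); last first.
    by apply/ffunP => -[i j]; rewrite !ffunE.
  apply/setXnP => i; rewrite ffunE inE; apply/andP; split.
    by apply/ffun_onP => j; rewrite ffunE; apply: (pS (Slot j)).
  apply/injectiveP => j1 j2; rewrite !ffunE => /p_inj /eqP.
  by rewrite eq_Tagged /= => /eqP.
- move=> [q /setXnP qX ->]; split.
  + apply/injectiveP => -[i1 j1] [i2 j2]; rewrite !ffunE /= => eq_q.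
    have qS i j : q i j \in S i.
      by have := qX i; rewrite inE => /andP[/ffun_onP /(_ j)].
    have [eq_i | ne_i] := eqVneq i1 i2.
      case: _ / eq_i in j2 eq_q *.
      by have := qX i1; rewrite inE => /andP[_ /injectiveP /(_ _ _ eq_q) ->].
    have := disjoint_setI0 (disjS _ _ ne_i) => /setP /(_ (q i1 j1)).
    by rewrite !inE qS /= eq_q qS.
  + apply/forallP => -[i j]; rewrite ffunE /=.
    by have := qX i; rewrite inE => /andP[/ffun_onP /(_ j)].
Qed.

Section Labels.
Variables (F : fieldType) (L : 'I_s -> {fset F}).

Local Notation E := (entries L).

Lemma entries_mem i x : x \in L i -> x \in E.
Proof.
move=> xL; rewrite in_fset1U; apply/orP; right.
by apply/bigfcupP; exists i; rewrite ?mem_enum.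
Qed.

(** Labels live in [entries L] rather than in F so as to range over a finite type. *)
Definition labellings : {set {ffun slot -> E}} :=
  [set l : {ffun slot -> E} | [forall d, fsval (l d) \in L (tag d)]].

Lemma card_labellings : #|labellings| = card_pow L kappa.
Proof.
have -> : #|labellings| =
    #|setXn (fun d : slot => [set e : E | fsval e \in L (tag d)])|.
  by apply: eq_card => l; rewrite inE; apply/forallP/setXnP => lP d;
    have := lP d; rewrite inE.
rewrite cardsXn /card_pow.
rewrite -(sig_big_dep xpredT (fun _ _ => true)
  (fun (i : 'I_s) (j : 'I_(kappa i)) => #|[set e : E | fsval e \in L i]|)).
apply: eq_bigr => i _; rewrite prod_nat_const card_ord; congr (_ ^ _)%N.
rewrite cardE -(size_map val); apply: perm_size; apply: uniq_perm.
- by rewrite map_inj_uniq ?enum_uniq //; apply: val_inj.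
- exact: fset_uniq.
- move=> x; apply/mapP/idP => [[e]|xL].
    by rewrite mem_enum inE => eL ->.
  by exists [` entries_mem xL]%fset; rewrite // mem_enum inE.
Qed.

End Labels.
End Placements.

(** * Counting columns through their fillings *)

Section Fillings.
Variables (s : nat) (kappa : 'I_s -> nat) (F : fieldType).
Variable L : 'I_s -> {fset F}.
Hypothesis L_neq0 : forall i, 0 \notin L i.
Hypothesis L_disjoint : forall i j, i != j -> [disjoint L i & L j]%fset.

Local Notation E := (entries L).
Local Notation D := (slot kappa).
Local Notation K := (\prod_i (kappa i)`!)%N.
Local Notation Lam := (card_pow L kappa).

Definition fillings m (v : 'cV[F]_m) : {set {ffun D -> 'I_m}} :=
  [set p : {ffun D -> 'I_m} |
    injectiveb p && [forall d, v (p d) ord0 \in L (tag d)]].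

Lemma L_inj x i j : x \in L i -> x \in L j -> i = j.
Proof.
move=> xi xj; apply/eqP; apply: contraT => ne_ij.
by have /fdisjointP /(_ _ xi) := L_disjoint ne_ij; rewrite xj.
Qed.

Lemma fillingsP m (v : 'cV[F]_m) (p : {ffun D -> 'I_m}) :
  reflect (injective p /\ forall d, v (p d) ord0 \in L (tag d))
          (p \in fillings v).
Proof.
rewrite inE; apply: (iffP andP) => -[p_inj pL].
  by split; [apply/injectiveP | apply/forallP].
by split; [apply/injectiveP | apply/forallP].
Qed.

Lemma card_fillings m (v : 'cV[F]_m) :
  LK_vector L kappa v -> #|fillings v| = K.
Proof.
move=> [cardv _].
rewrite -(@card_slot_fillings _ kappa _ (fun i => [set x | v x ord0 \in L i])) //.
  by apply: eq_card => p; rewrite !inE; congr andb; apply: eq_forallb => d; rewrite inE.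
move=> i j ne_ij; rewrite -setI_eq0; apply/eqP/setP => x; rewrite !inE.
by apply: contra_neqF ne_ij => /andP[]; apply: L_inj.
Qed.

Lemma fillings_neq0 m (v : 'cV[F]_m) :
  LK_vector L kappa v -> exists p, p \in fillings v.
Proof.
move=> LKv; apply/card_gt0P; rewrite card_fillings // prodn_gt0 // => i.
exact: fact_gt0.
Qed.

Lemma fillings_neq0_at m (v : 'cV[F]_m) (p : {ffun D -> 'I_m}) d :
  p \in fillings v -> v (p d) ord0 != 0.
Proof.
by case/fillingsP=> _ /(_ d); apply: contraTneq => ->; apply: L_neq0.
Qed.

(** The slots tagged i are injected into the kappa_i places with value in [L i], hence occupy all of
    them. *)
Lemma fillings_cover m (v : 'cV[F]_m) (p : {ffun D -> 'I_m}) x : LK_vector L kappa v ->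
  p \in fillings v -> v x ord0 != 0 -> exists d, x = p d.
Proof.
move=> [cardv suppv] /fillingsP[p_inj pL] vx.
case: (suppv x) => [vx0 | [i xi]]; first by rewrite vx0 eqxx in vx.
have : p @: [set d : D | tag d == i] == [set x | v x ord0 \in L i].
  rewrite eqEcard cardv card_imset // card_slot_tag leqnn andbT.
  by apply/subsetP => _ /imsetP[d + ->]; rewrite !inE => /eqP <-.
move/eqP/setP => /(_ x); rewrite inE xi => /imsetP[d _ ->].
by exists d.
Qed.

Lemma entries0 : 0 \in E. Proof. by rewrite in_fset1U eqxx. Qed.

(** When [p] is a filling of [v], the default value 0 is never reached. *)
Definition labels m (v : 'cV[F]_m) (p : {ffun D -> 'I_m}) : {ffun D -> E} :=
  [ffun d => insubd [` entries0]%fset (v (p d) ord0)].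

Lemma labelsE m (v : 'cV[F]_m) p d :
  p \in fillings v -> fsval (labels v p d) = v (p d) ord0.
Proof.
by case/fillingsP=> _ /(_ d) /entries_mem vE; rewrite ffunE insubdK.
Qed.

Lemma labels_in m (v : 'cV[F]_m) p :
  p \in fillings v -> labels v p \in labellings kappa L.
Proof.
move=> pv; rewrite inE; apply/forallP => d; rewrite labelsE //.
by case/fillingsP: pv.
Qed.

Lemma labels_inj m (v w : 'cV[F]_m) p : LK_vector L kappa v -> LK_vector L kappa w ->
  p \in fillings v -> p \in fillings w -> labels v p = labels w p -> v = w.
Proof.
move=> LKv LKw pv pw eq_l; apply/colP => x.
have [vx0|vx] := eqVneq (v x ord0) 0.
  have [->//|/(fillings_cover LKw pw)[d eq_x]] := eqVneq (w x ord0) 0.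
  by have := fillings_neq0_at d pv; rewrite -eq_x vx0 eqxx.
have [d ->] := fillings_cover LKv pv vx.
by rewrite -!labelsE // eq_l.
Qed.

Section Columns.
Variables (m n : nat) (A : 'M[F]_(m, n)).
Hypothesis A_LK : forall j, LK_vector L kappa (col j A).
Hypothesis A_inj : injective (fun j => col j A).

(** Each column has exactly K fillings, and a filling together with its labels determines the
    column, so these pairs inject into [Y]. *)
Lemma card_cols_fillings (J : {set 'I_n})
    (Y : {set {ffun D -> 'I_m} * {ffun D -> E}}) :
  (forall j p, j \in J -> p \in fillings (col j A) -> (p, labels (col j A) p) \in Y) ->
  (#|J| * K <= #|Y|)%N.
Proof.
move=> JY.
pose X := [set jp : 'I_n * {ffun D -> 'I_m} |
             (jp.1 \in J) && (jp.2 \in fillings (col jp.1 A))].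
have -> : (#|J| * K)%N = #|X|.
  rewrite -sum1dep_card -(pair_big_dep (mem J)
    (fun j p => p \in fillings (col j A)) (fun _ _ => 1%N)).
  by rewrite -sum_nat_const; apply: eq_bigr => j _; rewrite sum1_card card_fillings.
pose h (jp : 'I_n * {ffun D -> 'I_m}) := (jp.2, labels (col jp.1 A) jp.2).
rewrite -(@card_in_imset _ _ h).
  apply/subset_leq_card/subsetP => _ /imsetP[[j p] + ->].
  by rewrite inE => /andP[/= jJ pj]; apply: JY.
move=> [j p] [j' p'].
rewrite [(j, _) \in X]inE [(j', _) \in X]inE.
move=> /andP[_ /= pj] /andP[_ /= pj'] [eq_p eq_l].
rewrite -eq_p in pj' eq_l *.
by rewrite (A_inj (labels_inj (A_LK j) (A_LK j') pj pj' eq_l)).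
Qed.

(** All rows outside [Q] are merged into [None], which leaves |Q| + 1 values whatever the number of
    rows. *)
Definition truncate (Q : {set 'I_m}) (p : {ffun D -> 'I_m}) :
    {ffun D -> option 'I_m} :=
  [ffun d => if p d \in Q then Some (p d) else None].

(** One chosen filling per column suffices: its truncation and its labels give the entries on [Q],
    and these determine the column. *)
Lemma card_cols_truncate (Q : {set 'I_m}) (J : {set 'I_n})
    (Z : {set {ffun D -> option 'I_m}}) :
  (forall j j', (forall x, x \in Q -> A x j = A x j') -> j = j') ->
  (forall j p, j \in J -> p \in fillings (col j A) -> truncate Q p \in Z) ->
  (#|J| <= #|Z| * Lam)%N.
Proof.
move=> Q_det JZ.
pose c j := xchoose (fillings_neq0 (A_LK j)).
have cP j : c j \in fillings (col j A) by apply: xchooseP.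
pose h j := (truncate Q (c j), labels (col j A) (c j)).
rewrite -card_labellings -cardsX -(@card_in_imset _ _ h).
  apply/subset_leq_card/subsetP => _ /imsetP[j jJ ->].
  by rewrite in_setX (JZ j) //= labels_in.
move=> j j' _ _ [/ffunP eq_t eq_l]; apply: Q_det => x xQ.
have same d : c j d \in Q \/ c j' d \in Q -> c j d = c j' d.
  have := eq_t d; rewrite !ffunE.
  by case: (c j d \in Q); case: (c j' d \in Q) => //; [case | move=> _ []].
have [Ax0|Ax] := eqVneq (A x j) 0.
  have [->//|Ax'] := eqVneq (A x j') 0.
  have Ax'' : col j' A x ord0 != 0 by rewrite mxE.
  have [d eq_x] := fillings_cover (A_LK j') (cP j') Ax''.
  have cjd : c j d = c j' d by apply: same; right; rewrite -eq_x.
  by have := fillings_neq0_at d (cP j); rewrite cjd -eq_x mxE Ax0 eqxx.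
have Ax' : col j A x ord0 != 0 by rewrite mxE.
have [d eq_x] := fillings_cover (A_LK j) (cP j) Ax'.
have cjd : c j d = c j' d by apply: same; left; rewrite -eq_x.
have := labelsE d (cP j); rewrite eq_l labelsE // -cjd -eq_x !mxE.
by move=> ->.
Qed.

End Columns.
End Fillings.

(** * Union bounds for functions that hit a given set *)

Section FunctionCounting.

Lemma card_exists_le (I T : finType) (P : I -> pred T) :
  (#|[set q | [exists i, P i q]]| <= \sum_i #|[set q | P i q]|)%N.
Proof.
rewrite -sum1dep_card big_mkcond /=.
under [X in (_ <= X)%N]eq_bigr do rewrite -sum1dep_card big_mkcond /=.
rewrite exchange_big /=; apply: leq_sum => q _.
by case: existsP => // -[i Pi]; rewrite (bigD1 i) //= Pi.
Qed.

Variables (D T : finType) (X Y : {set T}).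

Lemma card_ffuns_prescribed (S : {set D}) :
  (#|[set q : {ffun D -> T} | [forall d, q d \in X] & [forall d in S, q d \in Y]]|
    <= #|Y| ^ #|S| * #|X| ^ (#|D| - #|S|))%N.
Proof.
have -> : (#|Y| ^ #|S| * #|X| ^ (#|D| - #|S|))%N =
    #|setXn (fun d : D => if d \in S then Y else X)|.
  rewrite cardsXn (bigID (mem S)) /=; congr (_ * _)%N.
    by rewrite -prod_nat_const; apply: eq_bigr => d ->.
  have -> : (#|D| - #|S|)%N = #|~: S| by rewrite [RHS]cardsCs setCK.
  rewrite -prod_nat_const; apply: eq_big => d; first by rewrite !inE.
  by rewrite inE => /negbTE ->.
apply/subset_leq_card/subsetP => q; rewrite inE => /andP[/forallP qX /forall_inP qY].
by apply/setXnP => d; case: ifP => [/qY|].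
Qed.

Lemma card_ffuns_hit1 :
  (#|[set q : {ffun D -> T} | [forall d, q d \in X] & [exists d, q d \in Y]]|
    <= #|D| * (#|Y| * #|X| ^ #|D|.-1))%N.
Proof.
pose P d := [pred q : {ffun D -> T} | [forall d, q d \in X] && (q d \in Y)].
have := card_exists_le P; set N := (\sum_i _)%N => le_N.
apply: leq_trans (_ : (N <= _)%N).
  apply: leq_trans le_N; apply/subset_leq_card/subsetP => q.
  rewrite !inE => /andP[qX /existsP[d qd]]; apply/existsP; exists d.
  by rewrite /= qX.
have sumD c : (#|D| * c = \sum_(d : D) c)%N by rewrite sum_nat_const.
rewrite sumD; apply: leq_sum => d _.
have := card_ffuns_prescribed [set d]; rewrite cards1 expn1 subn1.
apply: leq_trans; apply/subset_leq_card/subsetP => q; rewrite !inE /=.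
by case/andP=> -> qd; apply/forall_inP => e; rewrite inE => /eqP ->.
Qed.

(** Union bound over ordered pairs of distinct elements sent to [Y]. The factor |X| on the left
    turns the exponent |D| - 2 into |D| - 1, as in [card_ffuns_hit1]. *)
Lemma card_ffuns_hit2 :
  (#|[set q : {ffun D -> T} | [forall d, q d \in X] &
        [exists d : D * D, [&& d.1 != d.2, q d.1 \in Y & q d.2 \in Y]]]| * #|X|
    <= #|D| ^ 2 * (#|Y| ^ 2 * #|X| ^ #|D|.-1))%N.
Proof.
pose P (d : D * D) := [pred q : {ffun D -> T} |
  [forall d, q d \in X] && [&& d.1 != d.2, q d.1 \in Y & q d.2 \in Y]].
have := card_exists_le P; set N := (\sum_i _)%N => le_N.
apply: leq_trans (_ : (N * #|X| <= _)%N).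
  rewrite leq_mul2r; apply/orP; right.
  apply: leq_trans le_N; apply/subset_leq_card/subsetP => q.
  rewrite !inE => /andP[qX /existsP[d qd]]; apply/existsP; exists d.
  by rewrite /= qX.
rewrite big_distrl /=.
have sumDD c : (#|D| ^ 2 * c = \sum_(d : D * D) c)%N.
  by rewrite sum_nat_const card_prod.
rewrite sumDD; apply: leq_sum => -[d d'] _ /=.
have [<-|ne_d] := eqVneq d d'.
  rewrite (_ : [set _ | _] = set0) ?cards0 //.
  by apply/setP => q; rewrite !inE /= ?eqxx ?andbF.
have := card_ffuns_prescribed [set d; d']; rewrite cards2 ne_d /=.
have cardD : (1 < #|D|)%N.
  by apply: leq_trans (max_card (mem [set d; d'])); rewrite cards2 ne_d.
have -> : #|D|.-1 = (#|D| - 2).+1 by lia.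
rewrite [(#|X| ^ _.+1)%N]expnSr mulnA leq_mul2r => le2; apply/orP; right.
apply: leq_trans le2; apply/subset_leq_card/subsetP => q; rewrite !inE /=.
rewrite ?ne_d /= => /and3P[-> qd qd']; apply/forall_inP => e.
by rewrite !inE => /orP[] /eqP ->.
Qed.

End FunctionCounting.

(** * Counting columns under a linear relation between the rows *)

Section Violators.
Variables (s : nat) (kappa : 'I_s -> nat) (F : fieldType).
Variable L : 'I_s -> {fset F}.
Hypothesis L_neq0 : forall i, 0 \notin L i.
Hypothesis L_disjoint : forall i j, i != j -> [disjoint L i & L j]%fset.

Local Notation E := (entries L).
Local Notation D := (slot kappa).
Local Notation k := (\sum_i kappa i)%N.
Local Notation K := (\prod_i (kappa i)`!)%N.
Local Notation Lam := (card_pow L kappa).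

Definition placements m (B : {set 'I_m}) : {set {ffun D -> 'I_m} * {ffun D -> E}} :=
  setX [set p : {ffun D -> 'I_m} in ffun_on (mem B) | injectiveb p]
       (labellings kappa L).

Lemma card_placements m (B : {set 'I_m}) : #|placements B| = (#|B| ^_ k * Lam)%N.
Proof. by rewrite cardsX card_inj_ffuns_on card_slot card_labellings. Qed.

(** The scalar product of [y] with the vector that [pl] describes, as [sum_fillings] shows. *)
Definition pairing m (y : 'I_m -> F) (pl : {ffun D -> 'I_m} * {ffun D -> E}) : F :=
  \sum_d y (pl.1 d) * fsval (pl.2 d).

(** The descriptions that columns cannot have when [y] is a relation between the rows. *)
Definition violators m (B : {set 'I_m}) (y : 'I_m -> F) :=
  [set pl in placements B | pairing y pl != 0].

Lemma sum_fillings m (v : 'cV[F]_m) (p : {ffun D -> 'I_m}) (y : 'I_m -> F) :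
  LK_vector L kappa v -> p \in fillings kappa L v ->
  \sum_x y x * v x ord0 = pairing y (p, labels L v p).
Proof.
move=> LKv pv; have [p_inj _] := fillingsP _ _ _ pv.
rewrite (bigID (mem (p @: [set: D]))) /= addrC big1 => [|x x_p]; last first.
  have [->|/(fillings_cover LKv pv)[d eq_x]] := eqVneq (v x ord0) 0.
    by rewrite mulr0.
  by rewrite eq_x imset_f in x_p.
rewrite add0r big_imset /=; last by move=> d d' _ _; apply: p_inj.
apply: eq_big => [d|d _]; first by rewrite inE.
by rewrite labelsE.
Qed.

Lemma card_support m (v : 'cV[F]_m) :
  LK_vector L kappa v -> #|[set x | v x ord0 != 0]| = k.
Proof.
move=> LKv; have [p pv] := fillings_neq0 L_disjoint LKv.
have [p_inj _] := fillingsP _ _ _ pv.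
rewrite -card_slot -cardsT -(card_imset _ p_inj); apply: eq_card => x.
rewrite inE; apply/idP/imsetP => [/(fillings_cover LKv pv)[d ->]|[d _ ->]].
  by exists d.
exact: fillings_neq0_at pv.
Qed.

Section Columns.
Variables (m n : nat) (A : 'M[F]_(m, n)).
Hypothesis A_LK : forall j, LK_vector L kappa (col j A).
Hypothesis A_inj : injective (fun j => col j A).

(** The descriptions of the columns in [J] are placements in [B] with zero pairing, hence disjoint
    from the violators. *)
Lemma card_cols_within (B : {set 'I_m}) (y : 'I_m -> F) (J : {set 'I_n}) :
  (forall j x, j \in J -> A x j != 0 -> x \in B) ->
  (forall j, j \in J -> \sum_x y x * A x j = 0) ->
  (#|J| * K + #|violators B y| <= #|B| ^_ k * Lam)%N.
Proof.
move=> JB Jy.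
have -> : #|violators B y| = #|placements B :&: violators B y|.
  by rewrite (setIidPr _) //; apply/subsetP => pl; rewrite inE => /andP[].
rewrite -card_placements -(cardsID (violators B y) (placements B)) addnC leq_add2l.
apply: (card_cols_fillings L_neq0 L_disjoint A_LK A_inj) => j p jJ pj.
have [p_inj _] := fillingsP _ _ _ pj.
have pl_in : (p, labels L (col j A) p) \in placements B.
  rewrite in_setX labels_in // andbT inE; apply/andP; split; last exact/injectiveP.
  apply/ffun_onP => d; apply: JB jJ _.
  by have := fillings_neq0_at L_neq0 d pj; rewrite mxE.
rewrite !in_setD [_ \in violators _ _]inE pl_in /= negbK andbT.
rewrite -(sum_fillings _ (A_LK j) pj); apply/eqP; rewrite -[RHS](Jy j jJ).
by apply: eq_bigr => x _; rewrite mxE.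
Qed.

Variable Q : {set 'I_m}.
Hypothesis Q_det : forall j j', (forall x, x \in Q -> A x j = A x j') -> j = j'.

Let X : {set option 'I_m} := None |: (Some @: Q).

Let cardX : #|X| = #|Q|.+1.
Proof.
rewrite cardsU1 card_imset; last by move=> x y [].
by case: imsetP => [[]|].
Qed.

Let truncate_X (p : {ffun D -> 'I_m}) d : truncate Q p d \in X.
Proof. by rewrite ffunE !inE; case: ifP => // xQ; rewrite imset_f. Qed.

(** A nonzero entry outside [Q] belongs to a slot that truncation sends to [None]; this fixes one
    slot and leaves k - 1 of them free. *)
Lemma card_cols_leaving :
  (#|[set j | [exists x, (x \notin Q) && (A x j != 0)%R]]| <=
     k * #|Q|.+1 ^ k.-1 * Lam)%N.
Proof.
have := @card_ffuns_hit1 D _ X [set None].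
rewrite cards1 mul1n card_slot cardX; set Z := (Z in #|Z|) => leZ.
apply: leq_trans (_ : #|Z| * Lam <= _)%N; last by rewrite leq_mul2r leZ orbT.
apply: (card_cols_truncate L_neq0 L_disjoint A_LK Q_det) => j p.
rewrite inE => /existsP[x /andP[xQ Ax]] pj.
rewrite inE; apply/andP; split; first exact/forallP/truncate_X.
have Ax' : col j A x ord0 != 0 by rewrite mxE.
have [d eq_x] := fillings_cover (A_LK j) pj Ax'.
by apply/existsP; exists d; rewrite ffunE -eq_x (negbTE xQ) inE.
Qed.

(** Two nonzero entries in [T] occupy two distinct slots, and truncation keeps both because [T] lies
    in [Q]; then [card_ffuns_hit2] applies. *)
Lemma card_cols_hit2 (T : {set 'I_m}) : T \subset Q ->
  (#|[set j | [exists x : 'I_m * 'I_m, [&& x.1 \in T, x.2 \in T, x.1 != x.2,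
        (A x.1 j != 0)%R & (A x.2 j != 0)%R]]]| * #|Q|.+1 <=
     k ^ 2 * (#|T| ^ 2 * #|Q|.+1 ^ k.-1) * Lam)%N.
Proof.
move=> TQ; have := @card_ffuns_hit2 D _ X (Some @: T).
rewrite card_imset; last by move=> x y [].
rewrite card_slot cardX; set Z := (Z in #|Z|) => leZ.
apply: leq_trans (_ : #|Z| * #|Q|.+1 * Lam <= _)%N; last by rewrite leq_mul2r leZ orbT.
rewrite mulnAC leq_mul2r; apply/orP; right.
apply: (card_cols_truncate L_neq0 L_disjoint A_LK Q_det) => j p.
rewrite inE => /existsP[[x x'] /= /and5P[xT x'T ne_x Ax Ax']] pj.
rewrite inE; apply/andP; split; first exact/forallP/truncate_X.
have Av : col j A x ord0 != 0 by rewrite mxE.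
have Av' : col j A x' ord0 != 0 by rewrite mxE.
have [d eq_x] := fillings_cover (A_LK j) pj Av.
have [d' eq_x'] := fillings_cover (A_LK j) pj Av'.
apply/existsP; exists (d, d') => /=; rewrite !ffunE -eq_x -eq_x'.
rewrite !(subsetP TQ) // !imset_f // !andbT.
by apply: contraNneq ne_x => eq_d; rewrite eq_x eq_x' eq_d.
Qed.

End Columns.
End Violators.

(** * Extremal matrices: averaging over the rows, and the lower bound *)

Section Extremal.
Variables (s : nat) (kappa : 'I_s -> nat) (F : fieldType).
Variable L : 'I_s -> {fset F}.
Hypothesis L_neq0 : forall i, 0 \notin L i.
Hypothesis L_disjoint : forall i j, i != j -> [disjoint L i & L j]%fset.

Local Notation E := (entries L).
Local Notation D := (slot kappa).
Local Notation k := (\sum_i kappa i)%N.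
Local Notation K := (\prod_i (kappa i)`!)%N.
Local Notation Lam := (card_pow L kappa).
Local Notation ex := (exLK L kappa).

Definition admissible (r m n : nat) (A : 'M[F]_(m, n)) : Prop :=
  [/\ (\rank A <= r)%N, forall j, LK_vector L kappa (col j A)
    & injective (fun j => col j A)].

Lemma nb_distinct_cols_inj m n (A : 'M[F]_(m, n)) :
  injective (fun j => col j A) -> nb_distinct_cols A = n.
Proof.
move=> A_inj; rewrite /nb_distinct_cols undup_id; last first.
  by rewrite map_inj_uniq ?enum_uniq.
by rewrite size_map -cardE card_ord.
Qed.

Lemma admissible_le_ex r m n (A : 'M[F]_(m, n)) : admissible r A -> (n <= ex r)%N.
Proof.
move=> [rA A_LK A_inj]; rewrite /exLK; case: ex_maxnP => N _; apply.
apply/asboolP; exists m, n, A; split=> //; exact: nb_distinct_cols_inj.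
Qed.

Lemma rank_colsub m n n' (f : 'I_n' -> 'I_n) (A : 'M[F]_(m, n)) :
  (\rank (colsub f A) <= \rank A)%N.
Proof. by rewrite -[A in colsub f A]mulmx1 -mulmx_colsub mxrankM_maxl. Qed.

Lemma col_colsub m n n' (f : 'I_n' -> 'I_n) (A : 'M[F]_(m, n)) j :
  col j (colsub f A) = col (f j) A.
Proof. by apply/colP => x; rewrite !mxE. Qed.

Lemma colsub_admissible r m n n' (f : 'I_n' -> 'I_n) (A : 'M[F]_(m, n)) :
  injective f -> admissible r A -> admissible r (colsub f A).
Proof.
move=> f_inj [rA A_LK A_inj]; split.
- exact: leq_trans (rank_colsub f A) rA.
- by move=> j; rewrite col_colsub.
- by move=> j j' /=; rewrite !col_colsub => /A_inj /f_inj.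
Qed.

Lemma distinct_cols m n (A : 'M[F]_(m, n)) :
  exists f : 'I_(nb_distinct_cols A) -> 'I_n,
    injective (fun j => col j (colsub f A)) /\
    forall j, exists j', col j A = col j' (colsub f A).
Proof.
set c := undup (columns A).
have ex_col (j : 'I_(size c)) : exists j0, col j0 A = nth 0 c j.
  have : nth 0 c j \in columns A by rewrite -mem_undup mem_nth.
  by case/mapP=> j0 _ ->; exists j0.
have [f fP] := fin_all_exists ex_col; exists f; split.
  move=> j j' /=; rewrite !col_colsub !fP => /eqP.
  by rewrite nth_uniq ?undup_uniq // => /eqP/val_inj.
move=> j; have jc : col j A \in c.
  by rewrite mem_undup; apply/mapP; exists j; rewrite ?mem_enum.
have lt_j : (index (col j A) c < size c)%N by rewrite index_mem.
by exists (Ordinal lt_j); rewrite col_colsub fP nth_index.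
Qed.

Lemma ex_admissible r : exists m (A : 'M[F]_(m, ex r)), admissible r A.
Proof.
rewrite /exLK; case: ex_maxnP => N /asboolP[m [n [A [A_LK rA <-]]]] _.
have [f [f_inj _]] := distinct_cols A.
exists m, (colsub f A); split=> //.
- exact: leq_trans (rank_colsub f A) rA.
- by move=> j; rewrite col_colsub.
Qed.

Lemma nb_distinct_le_ex r m n (A : 'M[F]_(m, n)) :
    (\rank A <= r)%N -> (forall j, LK_vector L kappa (col j A)) ->
  (nb_distinct_cols A <= ex r)%N.
Proof.
move=> rA A_LK; rewrite /exLK; case: ex_maxnP => N _; apply.
by apply/asboolP; exists m, n, A.
Qed.

(** Restriction to the columns in [J] kills row [e], so the unit vector at [e] joins the left
    kernel, which grows strictly, and the rank drops. *)
Lemma card_cols_vanishing r m n (A : 'M[F]_(m, n)) (J : {set 'I_n}) e :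
    admissible r A -> row e A != 0 -> (forall j, j \in J -> A e j = 0) ->
  (#|J| <= ex r.-1)%N.
Proof.
move=> adA Ae J0; pose f : 'I_#|J| -> 'I_n := enum_val.
have f_inj : injective f by apply: enum_val_inj.
have [_ J_LK J_inj] := colsub_admissible f_inj adA.
case: adA => rA _ _.
apply: (@admissible_le_ex _ m _ (colsub f A)); split=> //.
suff: (\rank (colsub f A) < \rank A)%N by lia.
have ker_sub : (kermx A <= kermx (colsub f A))%MS.
  by apply/sub_kermxP; rewrite mulmx_colsub mulmx_ker; apply/matrixP => i j; rewrite !mxE.
have : (kermx A < kermx (colsub f A))%MS.
  rewrite ltmxE ker_sub /=; apply/negP => sub_ker.
  have : ((delta_mx 0 e : 'rV[F]_m) <= kermx (colsub f A))%MS.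
    apply/sub_kermxP; rewrite -rowE; apply/rowP => j; rewrite !mxE.
    by apply: J0; apply: enum_valP.
  by move=> /submx_trans /(_ sub_ker) /sub_kermxP; rewrite -rowE => /eqP; apply/negP.
move=> /rank_ltmx; rewrite !mxrank_ker.
by have := rank_leq_row A; lia.
Qed.

(** Double counting of the zero entries in nonzero rows: a column has only k nonzero entries, and
    [card_cols_vanishing] bounds the zeros of each nonzero row. *)
Lemma nb_nonzero_rows_bound r m n (A : 'M[F]_(m, n)) : admissible r A ->
  ((nb_nonzero_rows A - k) * n <= nb_nonzero_rows A * ex r.-1)%N.
Proof.
move=> adA; have [rA A_LK A_inj] := adA.
have card_supp j := card_support L_neq0 L_disjoint (A_LK j).
move: (\sum_i kappa i)%N card_supp => k card_supp.
rewrite /nb_nonzero_rows; set U := [set i | _].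
have suppU j x : A x j != 0 -> x \in U.
  by rewrite inE; apply: contraNneq => /rowP /(_ j); rewrite !mxE => ->.
rewrite -sum_nat_const.
apply: leq_trans (_ : \sum_(e in U) #|[set j | (A e j == 0)%R]| <= _)%N; last first.
  apply: leq_sum => e; rewrite inE => Ae.
  by apply: card_cols_vanishing adA Ae _ => j; rewrite inE => /eqP.
under eq_bigr do rewrite -sum1dep_card big_mkcond /=.
rewrite exchange_big /= mulnC -[X in (X * _)%N]card_ord -sum_nat_const.
apply: leq_sum => j _; rewrite -big_mkcondr sum1dep_card /=.
rewrite -(card_supp j) leq_subLR.
apply: leq_trans (leq_card_setU _ _).
apply/subset_leq_card/subsetP => x xU; rewrite in_setU inE mxE.
by case: eqVneq => //= Ax0; rewrite inE xU Ax0 eqxx.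
Qed.

(** The columns are supported in the nonzero rows, so [card_cols_within] applies with the zero
    relation. *)
Lemma nonzero_rows_bound m n (A : 'M[F]_(m, n)) :
    (forall j, LK_vector L kappa (col j A)) -> injective (fun j => col j A) ->
  (n * K <= nb_nonzero_rows A ^_ k * Lam)%N.
Proof.
move=> A_LK A_inj.
have suppU j x : j \in [set: 'I_n] -> A x j != 0 -> x \in [set i | row i A != 0].
  by move=> _; rewrite inE; apply: contraNneq => /rowP /(_ j); rewrite !mxE => ->.
have sum0 j : j \in [set: 'I_n] -> \sum_x (fun=> 0) x * A x j = 0.
  by move=> _; rewrite big1 // => x _; rewrite mul0r.
have := card_cols_within L_neq0 L_disjoint A_LK A_inj suppU sum0.
by rewrite cardsT card_ord; apply: leq_trans; apply: leq_addr.
Qed.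

(** The vector described by [pl]; when [pl.1] is injective the sum has at most one term. *)
Definition placed_vector m (pl : {ffun D -> 'I_m} * {ffun D -> E}) : 'cV[F]_m :=
  \col_x \sum_(d | pl.1 d == x) fsval (pl.2 d).

Lemma placed_vectorE m (p : {ffun D -> 'I_m}) (l : {ffun D -> E}) d :
  injective p -> placed_vector (p, l) (p d) ord0 = fsval (l d).
Proof.
move=> p_inj; rewrite mxE /= (big_pred1 d) // => d' /=.
by rewrite (inj_eq p_inj).
Qed.

Lemma placed_vector_LK m (p : {ffun D -> 'I_m}) (l : {ffun D -> E}) :
    injective p -> l \in labellings kappa L ->
  LK_vector L kappa (placed_vector (p, l)) /\ p \in fillings kappa L (placed_vector (p, l)).
Proof.
move=> p_inj; rewrite inE => /forallP lL.
have vals x : placed_vector (p, l) x ord0 = 0 \/ exists d, x = p d.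
  have [/existsP[d /eqP <-]|/existsPn no_d] := boolP [exists d, p d == x].
    by right; exists d.
  by left; rewrite mxE big1 // => d; rewrite /= (negbTE (no_d d)).
split; last first.
  by apply/fillingsP; split=> // d; rewrite placed_vectorE.
split=> [i | x]; last first.
  case: (vals x) => [|[d ->]]; [by left | right; exists (tag d)].
  by rewrite placed_vectorE.
rewrite -card_slot_tag -(card_imset _ p_inj); apply: eq_card => x; rewrite inE.
apply/idP/imsetP => [xi | [d + ->]]; last first.
  by rewrite inE placed_vectorE // => /eqP <-.
case: (vals x) => [x0|[d eq_x]]; first by rewrite x0 (negbTE (L_neq0 i)) in xi.
exists d => //; rewrite inE; apply/eqP.
by apply: (L_inj L_disjoint) (lL d) _; rewrite -(placed_vectorE l d p_inj) -eq_x.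
Qed.

(* Applied with y = 0 and m = r, or with y = 1 and m = r + 1. *)
Lemma ex_lower r m (y : 'I_m -> F) :
    (forall pl, pl \in placements kappa L setT -> pairing y pl = 0) ->
    ((exists x, y x != 0) -> (m <= r.+1)%N) -> (~ (exists x, y x != 0) -> (m <= r)%N) ->
  (m ^_ k * Lam <= ex r * K)%N.
Proof.
move=> y0 m_le m_le'.
set P := placements kappa L [set: 'I_m].
(* One column per placement. A vector occurs once for each of its fillings; [distinct_cols] removes
   the repetitions below. *)
pose A := \matrix_(x < m, j < #|P|) placed_vector (enum_val j) x ord0.
have colA j : col j A = placed_vector (enum_val j) by apply/colP => x; rewrite !mxE.
have plP pl : pl \in P -> injective pl.1 /\ pl.2 \in labellings kappa L.
  case: pl => p l; rewrite in_setX inE => /andP[/andP[_ /injectiveP]] //.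
have A_LK j : LK_vector L kappa (col j A).
  rewrite colA; have [] := plP _ (enum_valP j).
  by case: (enum_val j) => p l p_inj lL; have [] := placed_vector_LK p_inj lL.
(* A nonzero [y] lies in the left kernel and lowers the rank by one; otherwise the number of rows is
   already at most r. *)
have rA : (\rank A <= r)%N.
  pose w : 'rV[F]_m := \row_x y x.
  have [/[dup] /m_le le_m [x yx]|/m_le' le_m] := pselect (exists x, y x != 0); last first.
    exact: leq_trans (rank_leq_row A) le_m.
  have wA : w *m A = 0.
    apply/rowP => j; rewrite !mxE.
    have [] := plP _ (enum_valP j); have := y0 _ (enum_valP j).
    case eq_pl : (enum_val j) => [p l] py p_inj lL.
    have [LKv pv] := placed_vector_LK p_inj lL.
    transitivity (\sum_x y x * placed_vector (p, l) x ord0).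
      by apply: eq_bigr => x' _; rewrite !mxE eq_pl.
    rewrite (sum_fillings _ LKv pv) -[RHS]py.
    by apply: eq_bigr => d _; rewrite labelsE //= placed_vectorE.
  have := mulmx0_rank_max wA.
  have : (0 < \rank w)%N.
    by rewrite lt0n mxrank_eq0; apply: contraNneq yx => /rowP /(_ x); rewrite !mxE => ->.
  by lia.
have [f [f_inj f_surj]] := distinct_cols A.
apply: leq_trans (_ : nb_distinct_cols A * K <= _)%N; last first.
  by rewrite leq_mul2r nb_distinct_le_ex ?orbT.
pose Af := colsub f A.
have Af_LK j : LK_vector L kappa (col j Af) by rewrite col_colsub.
pose X := [set jp : 'I_(nb_distinct_cols A) * {ffun D -> 'I_m} |
             jp.2 \in fillings kappa L (col jp.1 Af)].
have <- : #|X| = (nb_distinct_cols A * K)%N.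
  rewrite -sum1dep_card.
  transitivity (\sum_j \sum_(p in fillings kappa L (col j Af)) 1)%N.
    by rewrite pair_big_dep.
  rewrite -[X in (X * _)%N]card_ord -sum_nat_const.
  by apply: eq_bigr => j _; rewrite sum1_card card_fillings.
rewrite -[X in (X ^_ _)%N]card_ord -cardsT -card_placements.
(* This map from pairs of a column and one of its fillings covers all placements. *)
pose h (jp : 'I_(nb_distinct_cols A) * {ffun D -> 'I_m}) :=
  (jp.2, labels L (col jp.1 Af) jp.2).
apply: leq_trans (leq_imset_card h X); apply/subset_leq_card/subsetP => -[p l] plP'.
have [p_inj lL] := plP _ plP'.
have [_ pv] := placed_vector_LK p_inj lL.
have [j eq_j] := f_surj (enum_rank_in plP' (p, l)).
rewrite colA enum_rankK_in // in eq_j.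
have pj : p \in fillings kappa L (col j Af) by rewrite -eq_j.
apply/imsetP; exists (j, p); first by rewrite inE.
congr (_, _); apply/ffunP => d; apply: val_inj; rewrite /= labelsE //.
by rewrite -eq_j placed_vectorE.
Qed.

End Extremal.

(** * Lower bounds for the number of violators *)

Section ViolatorBound.
Variables (s : nat) (kappa : 'I_s -> nat) (F : fieldType).
Variable L : 'I_s -> {fset F}.
Hypothesis L_neq0 : forall i, 0 \notin L i.

Local Notation E := (entries L).
Local Notation D := (slot kappa).
Local Notation k := (\sum_i kappa i)%N.
Local Notation Lam := (card_pow L kappa).

Lemma leq_ffact n n' j : (n <= n')%N -> (n ^_ j <= n' ^_ j)%N.
Proof. by move=> le_n; rewrite -!bin_ffact leq_mul2r leq_bin2l ?orbT. Qed.

Lemma subset_of_card (T : finType) (S : {set T}) n : (n <= #|S|)%N ->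
  exists2 S' : {set T}, S' \subset S & #|S'| = n.
Proof.
move=> le_n; exists [set x in take n (enum S)].
  by apply/subsetP => x; rewrite inE => /mem_take; rewrite mem_enum.
rewrite cardsE (card_uniqP _) ?take_uniq ?enum_uniq // size_take -cardE.
by case: ltngtP le_n.
Qed.

Definition overwrite (T : finType) (f : {ffun D -> T}) (d0 : D) (x : T) : {ffun D -> T} :=
  [ffun d => if d == d0 then x else f d].

Lemma placementsP m' (B' : {set 'I_m'}) (pl : {ffun D -> 'I_m'} * {ffun D -> E}) :
  reflect [/\ injective pl.1, forall d, pl.1 d \in B'
            & forall d, fsval (pl.2 d) \in L (tag d)]
          (pl \in placements kappa L B').
Proof.
case: pl => p l; rewrite in_setX; apply: (iffP andP) => /= -[].
  by rewrite !inE => /andP[/ffun_onP pB /injectiveP p_inj] /forallP lL.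
move=> p_inj pB lL; rewrite !inE; split; last exact/forallP.
by apply/andP; split; [apply/ffun_onP | apply/injectiveP].
Qed.

(* [g] moves the entry of slot [d0] so as to change its contribution to the
   pairing with [z].  It pairs off the placements with slot [d0] in [T] and the
   other slots outside [T] in such a way that at least half of them are
   violators. *)
Section Exchange.
Variables (m : nat) (z : 'I_m -> F) (d0 : D) (B T : {set 'I_m}).
Hypothesis TB : T \subset B.
Variable g : 'I_m * E -> 'I_m * E.

Let weight (xe : 'I_m * E) : F := z xe.1 * fsval xe.2.
Let dom (xe : 'I_m * E) := (xe.1 \in T) && (fsval xe.2 \in L (tag d0)).

Hypothesis g_dom : forall xe, dom xe -> dom (g xe).
Hypothesis g_weight : forall xe, dom xe -> weight (g xe) != weight xe.
Hypothesis g_inj : forall xe xe', dom xe -> dom xe' ->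
  weight xe = weight xe' -> g xe = g xe' -> xe = xe'.

Let Q : {set {ffun D -> 'I_m} * {ffun D -> E}} :=
  [set pl in placements kappa L B |
    (pl.1 d0 \in T) && [forall d, (d != d0) ==> (pl.1 d \notin T)]].

Let rest (pl : {ffun D -> 'I_m} * {ffun D -> E}) : F :=
  \sum_(d | d != d0) z (pl.1 d) * fsval (pl.2 d).

Let QP pl : reflect [/\ pl \in placements kappa L B, pl.1 d0 \in T
                      & forall d, d != d0 -> pl.1 d \notin T] (pl \in Q).
Proof.
rewrite [pl \in Q]inE; apply: (iffP and3P) => -[plB pT /= p_T]; split=> //.
  by move=> d; move/forallP: p_T => /(_ d) /implyP.
by apply/forallP => d; apply/implyP/p_T.
Qed.

(* Overwriting slot [d0] of a placement outside [T] by an element of [T] loses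
   only the old value of the slot, which lies in [B]. *)
Let card_Q : (#|T| * ((#|B| - #|T|) ^_ k * Lam) <= #|B| * #|Q|)%N.
Proof.
have <- : #|B :\: T| = (#|B| - #|T|)%N by rewrite cardsD (setIidPr TB).
rewrite -card_placements -!cardsX.
pose h (xpl : 'I_m * ({ffun D -> 'I_m} * {ffun D -> E})) :=
  (xpl.2.1 d0, (overwrite xpl.2.1 d0 xpl.1, xpl.2.2)).
rewrite -(@card_in_imset _ _ h).
  apply/subset_leq_card/subsetP => _ /imsetP[[x [p l]] + ->].
  rewrite in_setX => /andP[/= xT /placementsP[/= p_inj pB lL]].
  have pBT d : (p d \notin T) * (p d \in B) by have := pB d; rewrite inE => /andP[-> ->].
  rewrite in_setX pBT; apply/QP => /=; split.
  - apply/placementsP; split=> //= d; last first.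
      by rewrite ffunE; case: eqP => // _; [apply: (subsetP TB) | rewrite pBT].
    move=> d'; rewrite !ffunE; case: eqP => [->|_]; case: eqP => [->|_] //; last exact: p_inj.
      by move=> eq_x; have := pBT d'; rewrite -eq_x xT => -[].
    by move=> eq_x; have := pBT d; rewrite eq_x xT => -[].
  - by rewrite ffunE eqxx.
  - by move=> d ne_d; rewrite ffunE (negbTE ne_d) pBT.
move=> [x [p l]] [x' [p' l']] _ _ [eq_p0 /ffunP eq_p ->].
have eq_x : x = x' by have := eq_p d0; rewrite !ffunE eqxx.
rewrite -eq_x; congr (_, (_, _)); apply/ffunP => d.
by have := eq_p d; rewrite !ffunE; case: eqP => [->|].
Qed.

Let exchange (pl : {ffun D -> 'I_m} * {ffun D -> E}) :=
  let xe := g (pl.1 d0, pl.2 d0) in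
  (overwrite pl.1 d0 xe.1, overwrite pl.2 d0 xe.2).

Let pairing_rest pl : pairing z pl = weight (pl.1 d0, pl.2 d0) + rest pl.
Proof. by rewrite /pairing (bigD1 d0). Qed.

Let Q_dom pl : pl \in Q -> dom (pl.1 d0, pl.2 d0).
Proof. by case/QP=> /placementsP[_ _ lL] pT _; rewrite /dom /= pT lL. Qed.

Let exchange_rest pl : rest (exchange pl) = rest pl.
Proof. by apply: eq_bigr => d ne_d; rewrite !ffunE (negbTE ne_d). Qed.

Let exchange_at pl : ((exchange pl).1 d0, (exchange pl).2 d0) = g (pl.1 d0, pl.2 d0).
Proof. by rewrite !ffunE eqxx; case: (g _). Qed.

(** Only the weight at [d0] changes, so a zero pairing becomes nonzero. The new row stays in [T],
    away from all other slots, so injectivity survives. *)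
Let exchange_violates pl : pl \in Q :\: violators kappa L B z ->
  exchange pl \in violators kappa L B z.
Proof.
rewrite in_setD => /andP[+ plQ]; have dom_pl := Q_dom plQ.
case/QP: plQ => plB pT p_T; rewrite [pl \in violators _ _ _ _]inE plB /= negbK => /eqP pl0.
have /andP[gT gL] := g_dom dom_pl.
rewrite inE; apply/andP; split; last first.
  rewrite pairing_rest exchange_at exchange_rest.
  apply: contraNneq (g_weight dom_pl) => eq0.
  by rewrite -(inj_eq (addIr (rest pl))) eq0 -pairing_rest pl0.
case/placementsP: plB => p_inj pB lL.
apply/placementsP; split=> [d d'|d|d]; rewrite !ffunE /=.
- have p_g d1 : d1 != d0 -> pl.1 d1 != (g (pl.1 d0, pl.2 d0)).1.
    by move=> ne_d; apply: contraNneq (p_T d1 ne_d) => ->.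
  case: (eqVneq d d0) => [->|ne_d]; case: (eqVneq d' d0) => [->|ne_d'] //; last exact: p_inj.
    by move/esym/eqP; rewrite (negbTE (p_g _ _)).
  by move/eqP; rewrite (negbTE (p_g _ _)).
- by case: eqP => // _; apply: (subsetP TB).
- by case: eqP => [->|].
Qed.

Lemma card_violators_exchange :
  (#|T| * ((#|B| - #|T|) ^_ k * Lam) <= 2 * #|B| * #|violators kappa L B z|)%N.
Proof.
apply: leq_trans card_Q _; rewrite mulnAC [X in (_ <= X)%N]mulnC leq_mul2l; apply/orP; right.
rewrite -(cardsID (violators kappa L B z) Q) mul2n -addnn leq_add //.
  exact: subset_leq_card (subsetIr _ _).
rewrite -(@card_in_imset _ _ exchange).
  by apply/subset_leq_card/subsetP => _ /imsetP[pl plQ ->]; apply: exchange_violates.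
move=> pl pl'; rewrite !in_setD => /andP[+ plQ] /andP[+ plQ'].
have [plB _ _] := QP _ plQ; have [plB' _ _] := QP _ plQ'.
rewrite ![_ \in violators _ _ _ _]inE plB plB' /= !negbK => /eqP pl0 /eqP pl0' eq_x.
have eq_off d : d != d0 -> pl.1 d = pl'.1 d /\ pl.2 d = pl'.2 d.
  move=> ne_d; case: (eq_x) => /ffunP /(_ d) + /ffunP /(_ d).
  by rewrite !ffunE (negbTE ne_d).
have eq_rest : rest pl = rest pl'.
  by apply: eq_bigr => d /eq_off[-> ->].
(* Both pairings vanish and the rests agree, which gives the equality of weights that [g_inj] asks
   for. *)
have eq_w : weight (pl.1 d0, pl.2 d0) = weight (pl'.1 d0, pl'.2 d0).
  by apply: (addIr (rest pl)); rewrite -pairing_rest pl0 eq_rest -pairing_rest.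
have := g_inj (Q_dom plQ) (Q_dom plQ') eq_w.
rewrite -!exchange_at eq_x => /(_ erefl) [eq_p0 eq_l0].
rewrite [pl]surjective_pairing [pl']surjective_pairing.
by congr (_, _); apply/ffunP => d; have [->|/eq_off[]] := eqVneq d d0.
Qed.

End Exchange.

(** Greedy choice of n disjoint pairs of rows with different values of [z], swapped by [sigma]. The
    process stops early only if [z] is constant on what is left of [B]. *)
Lemma pairing_matching m (z : 'I_m -> F) (B : {set 'I_m}) n :
    (exists (T : {set 'I_m}) (sigma : {perm 'I_m}),
       [/\ T \subset B, #|T| = n.*2, perm_on T sigma
         & forall x, x \in T -> z (sigma x) != z x])
  \/ (exists (X : {set 'I_m}) (a : F),
       [/\ X \subset B, (#|B| <= #|X| + n.*2)%N & forall x, x \in X -> z x = a]).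
Proof.
elim: n => [|n [[T [sigma [TB cardT sT zT]]]|]]; last first.
- move=> [X [a [XB cardX zX]]]; right; exists X, a; split=> //.
  by rewrite doubleS; lia.
- have cardBT : #|B :\: T| = (#|B| - n.*2)%N by rewrite cardsD (setIidPr TB) cardT.
  have [[x [y [xBT yBT ne_z]]]|no_xy] :=
    pselect (exists x y, [/\ x \in B :\: T, y \in B :\: T & z x != z y]); last first.
    right; exists (B :\: T).
    have [BT0|[x xBT]] := set_0Vmem (B :\: T).
      exists 0; split=> [||x]; first exact: subsetDl.
        by rewrite doubleS cardBT; lia.
      by rewrite BT0 inE.
    exists (z x); split=> [||y yBT]; first exact: subsetDl.
      by rewrite doubleS cardBT; lia.
    by apply/eqP; apply: contraT => ne_z; case: no_xy; exists y, x.
  (* As [sigma] fixes [x] and [y], the product swaps them and acts on [T] as before. *)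
  left; exists (x |: (y |: T)), (tperm x y * sigma)%g.
  have ne_xy : x != y by apply: contraNneq ne_z => ->.
  case/setDP: xBT => xB xT; case/setDP: yBT => yB yT.
  have sx := out_perm sT xT; have sy := out_perm sT yT.
  split.
  + by rewrite !subUset !sub1set xB yB.
  + by rewrite !cardsU1 !inE (negbTE ne_xy) (negbTE xT) yT cardT doubleS.
  + apply/subsetP => u; apply: contraR; rewrite !inE !negb_or => /and3P[ux uy uT].
    by rewrite permM tpermD 1?eq_sym // (out_perm sT).
  + move=> u; rewrite !inE permM.
    case: tpermP => [->|->|/eqP ux /eqP uy].
    * by rewrite sy => _; rewrite eq_sym ne_z.
    * by rewrite sx => _; rewrite ne_z.
    * by rewrite (negbTE ux) (negbTE uy) /=; apply: zT.
- left; exists set0, 1%g; split=> //; rewrite ?sub0set ?cards0 //.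
    exact: perm_on1.
  by move=> x; rewrite inE.
Qed.

Hypothesis L_neq_fset0 : forall i, L i != fset0.

(** If some [L i] has two elements, exchange labels at rows where [z] is nonzero. If all are
    singletons, exchange rows with different values of [z]. If too few such pairs exist, [z] is
    almost constant, equal to some a, and a placement on the constant part pairs to a times the sum
    of the kappa_i ell_i. *)
Lemma violators_dichotomy m (z : 'I_m -> F) (B : {set 'I_m}) n :
    (0 < k)%N -> (forall i, 0 < kappa i)%N -> (n <= #|B|)%N ->
  [\/ (n.*2 * ((#|B| - n.*2) ^_ k * Lam) <= 2 * #|B| * #|violators kappa L B z|)%N,
      (#|[set x in B | (z x != 0)%R]| <= n.*2)%N
    | zero_sum_singletons L kappa /\
      exists2 a, a != 0 & (#|[set x in B | (z x != a)%R]| <= n.*2)%N].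
Proof.
move=> k_gt0 kappa_gt0 le_nB.
have [small|large] := leqP #|[set x in B | (z x != 0)%R]| n.*2; first exact: Or32.
have [[i L_big]|L_small] := pselect (exists i, (1 < #|` L i|)%N).
  apply: Or31.
  have [T TS cardT] := subset_of_card (ltnW large).
  have TB : T \subset B.
    by apply: subset_trans TS _; apply/subsetP => x; rewrite inE => /andP[].
  have [a aL] := fset0Pn _ (L_neq_fset0 i).
  have [b bL ne_ab] : exists2 b, b \in L i & b != a.
    have : (0 < #|` (L i `\ a)%fset|)%N by move: L_big; rewrite (cardfsD1 a) aL.
    by rewrite cardfs_gt0 => /fset0Pn[b]; rewrite !inE => /andP[ne_ba bL]; exists b.
  pose ea := [` entries_mem aL]%fset; pose eb := [` entries_mem bL]%fset.
  pose d0 : D := Tagged (fun i => 'I_(kappa i)) (Ordinal (kappa_gt0 i)).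
  (* All labels other than [ea] go to [ea], so [g] need not be injective; at a fixed row with [z]
     nonzero, equal weights already force equal labels. *)
  pose g (xe : 'I_m * E) := (xe.1, if xe.2 == ea then eb else ea).
  rewrite -cardT.
  apply: (@card_violators_exchange m z d0 B T TB g) => -[x e] /=.
  - by case/andP=> xT eL; rewrite xT /=; case: ifP.
  - case/andP=> xT eL; have : x \in [set x in B | z x != 0] by apply: (subsetP TS).
    rewrite inE => /andP[_ zx]; rewrite (inj_eq (mulfI zx)) (inj_eq val_inj).
    have [->|ne_e] := eqVneq e ea; last by rewrite eq_sym.
    by rewrite -(inj_eq val_inj).
  - move=> [x' e'] /= /andP[xT eL] _ + [eq_x _]; rewrite -eq_x => eq_w.
    have : x \in [set x in B | z x != 0] by apply: (subsetP TS).
    rewrite inE => /andP[_ zx]; congr (_, _); apply: val_inj; exact: (mulfI zx).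
have [ell ellP] : exists ell, forall i, L i = [fset ell i]%fset.
  have /choice[ell ellP] i : exists a, L i = [fset a]%fset.
    apply/cardfs1P; rewrite eqn_leq cardfs_gt0 L_neq_fset0 andbT leqNgt.
    by apply/negP => L_big; apply: L_small; exists i.
  by exists ell.
have slot0 : D.
  by apply: (enum_val (A := predT)); rewrite card_slot; exact: Ordinal k_gt0.
have [[T [sigma [TB cardT sT zT]]]|[X [a [XB cardX zX]]]] := pairing_matching z B n.
  apply: Or31; rewrite -cardT.
  pose g (xe : 'I_m * E) := (sigma xe.1, xe.2).
  apply: (@card_violators_exchange m z slot0 B T TB g) => -[x e] /=.
  - by case/andP=> xT eL; rewrite eL andbT (perm_closed _ sT).
  - case/andP=> xT eL; rewrite (inj_eq (mulIf _)) ?zT //.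
    by apply: contraNneq (L_neq0 (tag slot0)) => <-.
  - by move=> [x' e'] _ _ /= _ [/perm_inj -> ->].
have cardDX : (#|B :\: X| <= n.*2)%N by rewrite cardsD (setIidPr XB); lia.
have subDX b : b = a -> (#|[set x in B | (z x != b)%R]| <= n.*2)%N.
  move=> ->; apply: leq_trans cardDX; apply/subset_leq_card/subsetP => x.
  by rewrite !inE => /andP[->]; rewrite andbT; apply: contraNN => /zX ->.
have [a0|a_neq0] := eqVneq a 0.
  by have := subDX 0 (esym a0); rewrite leqNgt large.
have [zs|no_zs] := pselect (zero_sum_singletons L kappa).
  by apply: Or33; split=> //; exists a; last exact: subDX.
apply: Or31.
(* Without a zero sum, every placement in [X] is a violator. *)
have le_X : ((#|B| - n.*2) ^_ k * Lam <= #|violators kappa L B z|)%N.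
  apply: leq_trans (_ : #|X| ^_ k * Lam <= _)%N.
    by rewrite leq_mul2r leq_ffact ?orbT //; lia.
  rewrite -card_placements; apply/subset_leq_card/subsetP => pl /placementsP[p_inj pX lL].
  rewrite inE; apply/andP; split.
    by apply/placementsP; split=> // d; apply: (subsetP XB).
  apply: contra_notN no_zs => /eqP pl0; exists ell; split=> //.
  apply: (mulfI a_neq0); rewrite mulr0 -[RHS]pl0 mulr_sumr.
  transitivity (\sum_(i | xpredT i) \sum_(j < kappa i | true) a * ell i).
    by apply: eq_bigr => i _; rewrite sumr_const card_ord mulrnAr.
  rewrite sig_big_dep; apply: eq_bigr => d _; rewrite zX //.
  by have := lL d; rewrite ellP inE => /eqP ->.
by apply: leq_trans (leq_mul (_ : n.*2 <= 2 * #|B|)%N le_X) _ => //; lia.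
Qed.

End ViolatorBound.

Lemma leq_expW a b e : (a <= b)%N -> (a ^ e <= b ^ e)%N.
Proof. by case: e => // e le_ab; rewrite leq_exp2r. Qed.

(** * Row bases and the three alternatives at a given rank *)

Section OneRank.
Variables (s : nat) (kappa : 'I_s -> nat) (F : fieldType).
Variable L : 'I_s -> {fset F}.
Hypothesis L_neq0 : forall i, 0 \notin L i.
Hypothesis L_disjoint : forall i j, i != j -> [disjoint L i & L j]%fset.
Hypothesis L_neq_fset0 : forall i, L i != fset0.
Hypothesis kappa_gt0 : forall i, (0 < kappa i)%N.

Local Notation k := (\sum_i kappa i)%N.
Local Notation K := (\prod_i (kappa i)`!)%N.
Local Notation Lam := (card_pow L kappa).
Local Notation ex := (exLK L kappa).

Hypothesis k_gt0 : (0 < k)%N.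

Definition row_relation m n (A : 'M[F]_(m, n)) (y : 'I_m -> F) : Prop :=
  forall j, \sum_x y x * A x j = 0.

Lemma row_basis m n (A : 'M[F]_(m, n)) : exists Q : {set 'I_m},
  [/\ #|Q| = \rank A,
      forall j j', (forall x, x \in Q -> A x j = A x j') -> col j A = col j' A
    & forall e, e \notin Q -> exists2 y, row_relation A y &
        y e = 1 /\ forall x, x \notin Q -> x != e -> y x = 0].
Proof.
pose f := maxrankfun A.
have [M defA] : exists M, A = M *m rowsub f A.
  by apply/submxP; rewrite eq_maxrowsub.
have A_M x j : A x j = \sum_i M x i * A (f i) j.
  by rewrite {1}defA mxE; apply: eq_bigr => i _; rewrite mxE.
exists (f @: [set: 'I_(\rank A)]); split.
- by rewrite card_imset ?cardsT ?card_ord //; apply: maxrankfun_inj.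
- move=> j j' eqQ; apply/colP => x; rewrite !mxE !A_M.
  by apply: eq_bigr => i _; rewrite eqQ // imset_f.
(* Row [e] minus its expansion in the basis rows; the coefficients are collected over the fibres of
   [f]. *)
- move=> e eQ; exists (fun x => (x == e)%:R - \sum_(i | f i == x) M e i); last first.
    split=> [|x xQ ne_x].
      rewrite eqxx big1 ?subr0 // => i /eqP fi_e.
      by rewrite -fi_e imset_f in eQ.
    rewrite (negbTE ne_x) big1 ?subr0 // => i /eqP fi_x.
    by rewrite -fi_x imset_f in xQ.
  move=> j; under eq_bigr do rewrite mulrBl.
  rewrite sumrB (bigD1 e) //= eqxx mul1r big1 ?addr0 => [|x /negbTE->]; last by rewrite mul0r.
  apply/eqP; rewrite subr_eq0 A_M; apply/eqP.
  rewrite (partition_big f xpredT) //=; apply: eq_bigr => x _.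
  by rewrite mulr_suml; apply: eq_bigr => i /eqP ->.
Qed.

Section OneMatrix.
Variables (r m n : nat) (A : 'M[F]_(m, n)).
Hypothesis adA : admissible kappa L r A.

Let A_LK : forall j, LK_vector L kappa (col j A). Proof. by case: adA. Qed.
Let A_inj : injective (fun j => col j A). Proof. by case: adA. Qed.

(** Columns supported in [Q] obey [card_cols_within]; the others are the lower-order term of
    [card_cols_leaving]. *)
Lemma cols_violators_bound (Q : {set 'I_m}) (y : 'I_m -> F) :
    (forall j j', (forall x, x \in Q -> A x j = A x j') -> j = j') ->
    row_relation A y ->
  (n * K + #|violators kappa L Q y| <=
     #|Q| ^_ k * Lam + k * #|Q|.+1 ^ k.-1 * Lam * K)%N.
Proof.
move=> Q_det rel_y.
pose J := [set j | [exists x, (x \notin Q) && (A x j != 0)]].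
have le_out : (#|J| <= k * #|Q|.+1 ^ k.-1 * Lam)%N.
  have := card_cols_leaving L_neq0 L_disjoint A_LK Q_det; exact.
have le_in : (#|~: J| * K + #|violators kappa L Q y| <= #|Q| ^_ k * Lam)%N.
  apply: card_cols_within => // j x; rewrite !inE => /existsPn /(_ x) + Ax.
  by rewrite Ax andbT negbK.
have -> : n = (#|~: J| + #|J|)%N by rewrite addnC cardsC card_ord.
by rewrite mulnDl addnAC leq_add // leq_mul2r le_out orbT.
Qed.

(** The relation forbids a column to meet the support of [y] in [e] alone. So a column either
    vanishes at [e], or has two nonzero entries in a set of size at most t. *)
Lemma small_relation_bound (y : 'I_m -> F) e t :
    row_relation A y -> y e != 0 -> row e A != 0 ->
    (#|[set x | (y x != 0)%R]| <= t)%N -> (\rank A = r)%N ->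
  (n * r <= ex r.-1 * r + k ^ 2 * (t ^ 2 * (r + t).+1 ^ k.-1) * Lam)%N.
Proof.
move=> rel_y ye Ae; set T := [set x | _] => card_T rankA.
have [Q [cardQ Q_det _]] := row_basis A.
(* Adjoining [T] to the basis meets the inclusion required by [card_cols_hit2]; the size stays
   between r and r + t. *)
have QT_det j j' : (forall x, x \in Q :|: T -> A x j = A x j') -> j = j'.
  move=> eqQT; apply: A_inj; apply: Q_det => x xQ.
  by apply: eqQT; rewrite inE xQ.
have cardJ := card_cols_hit2 L_neq0 L_disjoint A_LK QT_det (subsetUr Q T).
set J : {set 'I_n} := [set j | _] in cardJ.
have card_cJ : (#|~: J| <= ex r.-1)%N.
  apply: (@card_cols_vanishing _ _ _ _ r m n A _ e adA Ae) => j.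
  rewrite !inE; apply: contraNeq => Aej; apply/existsP.
  have [/existsP[x /and3P[xT ne_x Ax]]|/existsPn no_x] :=
    boolP [exists x, [&& x \in T, e != x & A x j != 0]].
    by exists (e, x); rewrite /= xT ne_x Aej Ax !andbT inE.
  have := rel_y j; rewrite (bigD1 e) //= big1 => [|x ne_x].
    by move/eqP; rewrite addr0 mulf_eq0 (negbTE ye) (negbTE Aej).
  have := no_x x; rewrite eq_sym ne_x /= inE negb_and !negbK.
  by case/orP=> /eqP ->; rewrite ?mul0r ?mulr0.
have -> : n = (#|~: J| + #|J|)%N by rewrite addnC cardsC card_ord.
rewrite mulnDl leq_add // ?leq_mul2r ?card_cJ ?orbT //.
have leQT : (r <= #|Q :|: T|)%N by rewrite -rankA -cardQ subset_leq_card // subsetUl.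
have geQT : (#|Q :|: T| <= r + t)%N.
  by apply: leq_trans (leq_card_setU _ _) _; rewrite cardQ rankA leq_add2l.
apply: leq_trans (_ : #|J| * #|Q :|: T|.+1 <= _)%N; first by rewrite leq_mul2l leqW ?orbT.
apply: leq_trans cardJ _; rewrite leq_mul2r; apply/orP; right.
by rewrite leq_mul2l leq_mul ?orbT // leq_expW.
Qed.

(* [t] bounds the support of a combination of two relations, each of which is
   constant on Q up to n0.*2 places and has one more place outside Q. *)
Lemma rank_trichotomy (n0 : nat) (t := n0.*2.*2.+2) : (n0 <= r)%N ->
  [\/ (nb_nonzero_rows A <= r + `[< zero_sum_singletons L kappa >])%N,
      (n * r <= ex r.-1 * r + k ^ 2 * (t ^ 2 * (r + t).+1 ^ k.-1) * Lam)%N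
    | exists2 V, (n0.*2 * ((r - n0.*2) ^_ k * Lam) <= 2 * r * V)%N &
        (n * K + V <= r ^_ k * Lam + k * r.+1 ^ k.-1 * Lam * K)%N].
Proof.
move=> le_n0r; have [rA _ _] := adA.
(* With rank below r, the matrix already competes for ex(r - 1). *)
have [lt_rA|ge_rA] := ltnP (\rank A) r.
  apply: Or32; apply: leq_trans (leq_addr _ _); rewrite leq_mul2r; apply/orP; right.
  by apply: (@admissible_le_ex _ _ _ _ _ _ _ A); split=> //; lia.
have rankA : \rank A = r by apply/eqP; rewrite eqn_leq rA.
have [le_U|lt_U] := leqP (nb_nonzero_rows A) (r + `[< zero_sum_singletons L kappa >]).
  exact: Or31.
have [Q [cardQ Q_detc Q_rel]] := row_basis A.
rewrite rankA in cardQ.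
have Q_det j j' : (forall x, x \in Q -> A x j = A x j') -> j = j'.
  by move=> /Q_detc; apply: A_inj.
have outside (S : {set 'I_m}) : (#|S| < nb_nonzero_rows A)%N ->
    exists2 e, row e A != 0 & e \notin S.
  move=> lt_S; have : (0 < #|[set i | (row i A != 0)%R] :\: S|)%N.
    rewrite cardsD subn_gt0; apply: leq_ltn_trans lt_S.
    exact: subset_leq_card (subsetIr _ _).
  by case/card_gt0P=> e; rewrite !inE => /andP[eS Ae]; exists e.
have dichotomy e : row e A != 0 -> e \notin Q ->
    ((n * r <= ex r.-1 * r + k ^ 2 * (t ^ 2 * (r + t).+1 ^ k.-1) * Lam)%N \/
     exists2 V, (n0.*2 * ((r - n0.*2) ^_ k * Lam) <= 2 * r * V)%N &
        (n * K + V <= r ^_ k * Lam + k * r.+1 ^ k.-1 * Lam * K)%N) \/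
    zero_sum_singletons L kappa /\ exists y a, [/\ row_relation A y, y e = 1,
      forall x, x \notin Q -> x != e -> y x = 0, a != 0
      & (#|[set x in Q | (y x != a)%R]| <= n0.*2)%N].
  move=> Ae eQ; have [y rel_y [ye y_out]] := Q_rel e eQ.
  have le_n0Q : (n0 <= #|Q|)%N by rewrite cardQ.
  case: (violators_dichotomy L_neq0 L_neq_fset0 y k_gt0 kappa_gt0 le_n0Q).
  - move=> le_V; left; right; exists #|violators kappa L Q y|; first by rewrite -cardQ.
    by rewrite -cardQ; apply: cols_violators_bound.
  - move=> small; left; left; apply: (small_relation_bound rel_y _ Ae _ rankA).
      by rewrite ye oner_neq0.
    apply: leq_trans (_ : #|e |: [set x in Q | (y x != 0)%R]| <= _)%N.
      apply/subset_leq_card/subsetP => x; rewrite !inE => yx.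
      have [//|ne_x /=] := eqVneq x e; rewrite yx andbT.
      by apply: contraNT yx => xQ; rewrite y_out.
    apply: leq_trans (leq_card_setU _ _) _; rewrite cards1.
    by apply: leq_trans (leq_add (leqnn 1) small) _; rewrite /t; lia.
  - by move=> [zs [a a_neq0 small]]; right; split=> //; exists y, a.
have [|e Ae eQ] := outside Q; first by rewrite cardQ; lia.
case: (dichotomy e Ae eQ) => [[]|[zs [y [a [rel_y ye y_out a_neq0 y_a]]]]];
  [exact: Or32|exact: Or33|].
rewrite (asboolT zs) addn1 in lt_U.
(* In the zero-sum case more than r + 1 rows are nonzero, which leaves a second one outside the
   basis. *)
have [|e' Ae' eQ'] := outside (e |: Q).
  by rewrite cardsU1 eQ cardQ.
move: eQ'; rewrite !inE negb_or => /andP[ne_e eQ'].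
case: (dichotomy e' Ae' eQ') => [[]|[_ [y' [a' [rel_y' ye' y_out' a_neq0' y_a']]]]];
  [exact: Or32|exact: Or33|].
apply: Or32.
(* The two constants cancel on [Q] up to 4 n0 places, and the rows [e] and [e'] account for the + 2
   in [t]. At [e] the value is a', since [y'] vanishes there. *)
pose w x := a' * y x - a * y' x.
have rel_w : row_relation A w.
  move=> j; under eq_bigr do rewrite mulrBl -!mulrA.
  by rewrite sumrB -!mulr_sumr rel_y rel_y' !mulr0 subr0.
apply: (small_relation_bound rel_w _ Ae _ rankA).
  by rewrite /w ye y_out' ?mulr1 ?mulr0 ?subr0 // eq_sym.
apply: leq_trans (_ : #|(e |: [set e']) :|:
    ([set x in Q | (y x != a)%R] :|: [set x in Q | (y' x != a')%R])| <= _)%N.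
  apply/subset_leq_card/subsetP => x; rewrite !inE => wx.
  have [//|ne_x /=] := eqVneq x e; have [//|ne_x' /=] := eqVneq x e'.
  have [xQ|xQ] := boolP (x \in Q); last by rewrite /w y_out // y_out' // !mulr0 subr0 eqxx in wx.
  rewrite -negb_and; apply: contraNN wx => /andP[/eqP yx /eqP yx'].
  by rewrite /w yx yx' mulrC subrr.
apply: leq_trans (leq_card_setU _ _) _.
apply: leq_trans (leq_add (leqnn _) (leq_card_setU _ _)) _.
apply: leq_trans (leq_add (leqnn _) (leq_add y_a y_a')) _.
by rewrite cardsU1 cards1 /t; case: (_ \notin _); lia.
Qed.

End OneMatrix.
End OneRank.

(** * Numerical estimates *)

Section Arithmetic.
Local Open Scope nat_scope.

Lemma ffact_succ n j : n.+1 ^_ j.+1 = n ^_ j.+1 + j.+1 * n ^_ j.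
Proof.
rewrite ffactSS ffactnSr; have [le_jn|lt_nj] := leqP j n.
  by rewrite -[n in n.+1](subnK le_jn) -addnS mulnDl [_ * (n - j)]mulnC.
by rewrite ffact_small // !muln0.
Qed.

(** Each of the [w] unit steps adds at least the increment at n, by [ffact_succ] and
    monotonicity. *)
Lemma ffact_add_ge n w j : n ^_ j.+1 + w * (j.+1 * n ^_ j) <= (n + w) ^_ j.+1.
Proof.
elim: w => [|w IHw]; first by rewrite mul0n !addn0.
rewrite addnS ffact_succ mulSn addnCA addnC leq_add // leq_mul2l /=.
by rewrite leq_ffact ?leq_addr.
Qed.

Lemma expn_sub_le_ffact n j : (n - j) ^ j <= n ^_ j.
Proof.
elim: j => // j IHj; rewrite ffactnSr expnSr leq_mul //; last by lia.
by apply: leq_trans IHj; apply: leq_expW; lia.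
Qed.

(** Too few rows contradict [lower] and [upper]. Too many contradict the averaging inequality, which
    after division by the common factor P reads (u - k)(g + 1) <= u (g + 1 - k), that is u <= g +
    1. *)
Lemma nonzero_rows_arith k u g n e Lam K : 0 < k -> k <= g.+1 -> 0 < Lam ->
    (u - k) * n <= u * e -> e * K = g ^_ k * Lam ->
    g.+1 ^_ k * Lam <= n * K -> n * K <= u ^_ k * Lam ->
  u = g.+1.
Proof.
case: k => // j _; rewrite ltnS => le_jg Lam_gt0 ratio eqe lower upper.
have P_gt0 : 0 < g ^_ j * Lam by rewrite muln_gt0 ffact_gt0 le_jg.
rewrite ffactnSr mulnAC in eqe; rewrite ffactSS -mulnA in lower.
have [P defP] : exists P, P = g ^_ j * Lam by exists (g ^_ j * Lam).
rewrite -defP in P_gt0 eqe lower.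
have [lt_u|lt_u|//] := ltngtP u g.+1.
  have : u ^_ j.+1 * Lam <= P * (g - j).
    by rewrite defP mulnAC -ffactnSr leq_mul2r leq_ffact ?orbT.
  by move: (leq_trans lower upper) => ? ?; nia.
have ratioK : (u - j.+1) * (n * K) <= u * (P * (g - j)).
  by rewrite -eqe !mulnA leq_mul2r ratio orbT.
have : (u - j.+1) * (g.+1 * P) <= u * (P * (g - j)).
  by apply: leq_trans ratioK; rewrite leq_mul2l lower orbT.
rewrite mulnA mulnCA [P * _]mulnC leq_pmul2r //.
have [v ->] : exists v, u = g.+2 + v by exists (u - g.+2); rewrite subnKC.
have [h ->] : exists h, g = j + h by exists (g - j); rewrite subnKC.
have -> : (j + h).+2 + v - j.+1 = h.+1 + v by lia.
by rewrite addKn; nia.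
Qed.

(** Otherwise V is at most k (r + 1)^(k - 1) Lam K, while [n0], chosen just above 2^k K k, makes V
    larger. *)
Lemma few_violators_arith k K Lam r n V : 0 < k -> 0 < K -> 0 < Lam ->
    let n0 := (2 ^ k * K * k).+1 in 4 * n0 + 2 * k + 1 <= r ->
    n0.*2 * ((r - n0.*2) ^_ k * Lam) <= 2 * r * V ->
    n * K + V <= r ^_ k * Lam + k * r.+1 ^ k.-1 * Lam * K ->
  n * K < r ^_ k * Lam.
Proof.
move=> k_gt0 K_gt0 Lam_gt0 n0 le_r le_V le_n; rewrite ltnNge; apply/negP => ge_n.
have {le_n ge_n} V_small : V <= k * r.+1 ^ k.-1 * Lam * K.
  by move: (leq_add ge_n (leqnn V)) => /leq_trans /(_ le_n); rewrite leq_add2l.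
(* No factor of the falling factorial in [le_V] is below X, and r + 1 <= 2 X, so both estimates of V
   compare with powers of X. *)
pose X := r - n0.*2 - k.
have le_rX : r.+1 <= 2 * X by rewrite /X; lia.
have X_gt0 : 0 < X ^ k by rewrite expn_gt0; apply/orP; left; rewrite /X; lia.
have : n0.*2 * (X ^ k * Lam) <= 2 * (2 * X) * (k * (2 * X) ^ k.-1 * Lam * K).
  apply: leq_trans (_ : _ <= 2 * r * V) _; first apply: leq_trans le_V.
    by rewrite leq_mul2l leq_mul2r expn_sub_le_ffact !orbT.
  apply: leq_mul; first by lia.
  by apply: leq_trans V_small _; rewrite !leq_mul2r leq_mul2l leq_expW ?orbT.
have -> : 2 * (2 * X) * (k * (2 * X) ^ k.-1 * Lam * K) =
          2 * (2 ^ k * K * k) * (X ^ k * Lam).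
  have -> : 2 * (2 ^ k * K * k) * (X ^ k * Lam) = 2 * ((2 * X) ^ k * (K * k * Lam)).
    by rewrite expnMn; nia.
  rewrite -mulnA; congr (2 * _); rewrite -[X in _ = _ ^ X * _](prednK k_gt0) expnS.
  by nia.
rewrite leq_pmul2r; last by rewrite muln_gt0 X_gt0.
by rewrite /n0; lia.
Qed.

(** If every increment in the window were small, x(R + W) - x(R) would be of order W R^(k - 2). The
    bounds on x make it at least of order R^(k - 1), because W is twice the factor 2^(k - 1) K
    needed to absorb the error term in [upper]. *)
Lemma window_arith (x : nat -> nat) k K Lam t c R (W := 2 ^ k * K) :
    0 < k -> 0 < K -> 0 < Lam -> 2 * k + W + t + 1 <= R -> W * c < R ->
    (forall r, r ^_ k * Lam <= x r * K) ->
    (forall r, x r * K <= r ^_ k * Lam + k * r.+1 ^ k.-1 * Lam * K) ->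
  exists2 r, R < r <= R + W & x r.-1 * r + c * (r + t).+1 ^ k.-1 * Lam < x r * r.
Proof.
move=> k_gt0 K_gt0 Lam_gt0 large_R large_R' lower upper.
apply: contrapT => no_r.
pose h := c * (R + W + t).+1 ^ k.-1 * Lam.
have step r : R < r <= R + W -> x r * R <= x r.-1 * R + h.
  move=> rRW; have : x r * r <= x r.-1 * r + h.
    apply: leq_trans (_ : x r.-1 * r + c * (r + t).+1 ^ k.-1 * Lam <= _).
      by rewrite leqNgt; apply/negP => lt_x; apply: no_r; exists r.
    by rewrite leq_add2l leq_mul2r leq_mul2l leq_expW ?orbT //; lia.
  have [le_x _|lt_x] := leqP (x r) (x r.-1).
    by apply: leq_trans (leq_addr _ _); rewrite leq_mul2r le_x orbT.
  have [d ->] : exists d, x r = x r.-1 + d by exists (x r - x r.-1); rewrite subnKC // ltnW.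
  rewrite !mulnDl !leq_add2l; apply: leq_trans; rewrite leq_mul2l; lia.
have steps w : w <= W -> x (R + w) * R <= x R * R + w * h.
  elim: w => [|w IHw] le_w; first by rewrite addn0 mul0n addn0.
  have := step (R + w.+1); rewrite addnS /= => /(_ _) le1.
  apply: leq_trans (le1 _) _; first by lia.
  by rewrite mulSn [h + _]addnC addnA leq_add2r IHw // ltnW.
case: k => // j in k_gt0 W large_R large_R' lower upper no_r h step steps *.
rewrite /= in upper h step steps *.
(* A common unit for the powers near R: p is at most the falling factorial of R, and both error
   powers are at most b p. *)
pose p := (R - j.+1) ^ j; pose b := 2 ^ j.
have p_gt0 : 0 < p by rewrite expn_gt0; apply/orP; left; lia.
have b_gt0 : 0 < b by rewrite expn_gt0.
have bp n : n <= 2 * (R - j.+1) -> n ^ j <= b * p.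
  by move=> le_n; rewrite -expnMn leq_expW.
have R1 : R.+1 ^ j <= b * p by apply: bp; lia.
have R2 : (R + W + t).+1 ^ j <= b * p by apply: bp; lia.
have Rp : p <= R ^_ j.
  by apply: leq_trans (expn_sub_le_ffact R j); apply: leq_expW; lia.
have total : (R + W) ^_ j.+1 * Lam * R <=
    (R ^_ j.+1 * Lam + j.+1 * R.+1 ^ j * Lam * K) * R + K * (W * h).
  apply: leq_trans (_ : x (R + W) * K * R <= _); first by rewrite leq_mul2r lower orbT.
  rewrite mulnAC; apply: leq_trans (leq_mul (steps W (leqnn _)) (leqnn K)) _.
  rewrite mulnDl [K * _]mulnC leq_add2r mulnAC leq_mul2r upper ?orbT //.
have {total} : W * (j.+1 * p) * R <= j.+1 * (b * p) * K * R + K * (W * (c * (b * p))).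
  rewrite -(leq_pmul2r Lam_gt0).
  have grow : R ^_ j.+1 * Lam * R + W * (j.+1 * p) * R * Lam <= (R + W) ^_ j.+1 * Lam * R.
    apply: leq_trans (_ : (R ^_ j.+1 + W * (j.+1 * R ^_ j)) * Lam * R <= _); last first.
      by rewrite !leq_mul2r ffact_add_ge !orbT.
    rewrite !mulnDl leq_add2l mulnAC leq_mul2r leq_mul2r !leq_mul2l Rp !orbT //.
  have := leq_trans grow total; rewrite [X in _ <= X + _]mulnDl -addnA leq_add2l.
  move=> /leq_trans; apply; rewrite mulnDl leq_add //.
    rewrite [X in _ <= X]mulnAC leq_mul2r; apply/orP; right.
    by rewrite mulnAC !leq_mul2r leq_mul2l R1 !orbT.
  by rewrite /h -!mulnA !leq_mul2l mulnA leq_mul2r R2 !orbT.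
(* As W = 2 b K, half of the left side cancels the first term on the right; what remains contradicts
   W c < R. *)
have -> : W * (j.+1 * p) * R = 2 * (b * K * j.+1 * R) * p by rewrite /W /b expnS; nia.
have -> : j.+1 * (b * p) * K * R + K * (W * (c * (b * p))) =
          (b * K * (j.+1 * R) + b * K * (W * c)) * p by nia.
rewrite leq_pmul2r // -[b * K * j.+1 * R]mulnA mul2n -addnn leq_add2l leq_pmul2l; last first.
  by rewrite muln_gt0 b_gt0.
by nia.
Qed.

End Arithmetic.

(** * From one rank to all larger ranks *)

Section Conclusion.
Variables (s : nat) (kappa : 'I_s -> nat) (F : fieldType).
Variable L : 'I_s -> {fset F}.
Hypothesis L_neq0 : forall i, 0 \notin L i.
Hypothesis L_disjoint : forall i j, i != j -> [disjoint L i & L j]%fset.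

Local Notation k := (\sum_i kappa i)%N.
Local Notation K := (\prod_i (kappa i)`!)%N.
Local Notation Lam := (card_pow L kappa).
Local Notation ex := (exLK L kappa).
Local Notation delta := `[< zero_sum_singletons L kappa >].

Lemma ex_ge r : ((r + delta) ^_ k * Lam <= ex r * K)%N.
Proof.
case: asboolP => [[ell [ellP sum0]]|_].
  rewrite addn1; apply: (ex_lower L_neq0 L_disjoint (y := fun=> 1)) => [pl||[]].
  - move=> /placementsP[_ _ lL].
    transitivity (\sum_(i | xpredT i) \sum_(j < kappa i | true) ell i).
      rewrite sig_big_dep; apply: eq_bigr => d _; rewrite mul1r.
      by have := lL d; rewrite ellP inE => /eqP.
    by rewrite -[RHS]sum0; apply: eq_bigr => i _; rewrite sumr_const card_ord.
  - by [].
  - by exists ord0; apply: oner_neq0.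
rewrite addn0; apply: (ex_lower L_neq0 L_disjoint (y := fun=> 0)) => [pl _|[x]|//].
  by rewrite /pairing big1 // => d _; rewrite mul0r.
by rewrite eqxx.
Qed.

(** With the zero relation, [cols_violators_bound] counts the columns inside a row basis plus those
    leaving it. *)
Lemma ex_le r : (ex r * K <= r ^_ k * Lam + k * r.+1 ^ k.-1 * Lam * K)%N.
Proof.
have [m [A adA]] := ex_admissible kappa L r; have [rA _ A_inj] := adA.
have [Q [cardQ Q_det _]] := row_basis A.
have le_Qr : (#|Q| <= r)%N by rewrite cardQ.
have rel0 : row_relation A (fun=> 0).
  by move=> j; rewrite big1 // => x _; rewrite mul0r.
have Q_det' j j' : (forall x, x \in Q -> A x j = A x j') -> j = j'.
  by move=> /Q_det; apply: A_inj.
have := cols_violators_bound L_neq0 L_disjoint adA Q_det' rel0.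
move=> /(leq_trans (leq_addr _ _)) /leq_trans; apply.
rewrite leq_add //; first by rewrite leq_mul2r leq_ffact ?orbT.
by rewrite !leq_mul2r leq_mul2l leq_expW ?orbT.
Qed.

Lemma ex_attained_rows r m (A : 'M[F]_(m, ex r)) : admissible kappa L r A ->
    (nb_nonzero_rows A <= r + delta)%N ->
  (ex r * K = (r + delta) ^_ k * Lam)%N.
Proof.
move=> [_ A_LK A_inj] le_rows; apply/eqP; rewrite eqn_leq ex_ge andbT.
apply: leq_trans (nonzero_rows_bound L_neq0 L_disjoint A_LK A_inj) _.
by rewrite leq_mul2r leq_ffact ?orbT.
Qed.

Hypothesis L_neq_fset0 : forall i, L i != fset0.
Hypothesis kappa_gt0 : forall i, (0 < kappa i)%N.
Hypothesis k_gt0 : (0 < k)%N.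

Let K_gt0 : (0 < K)%N.
Proof. by rewrite prodn_gt0 // => i; apply: fact_gt0. Qed.

Let Lam_gt0 : (0 < Lam)%N.
Proof. by rewrite prodn_gt0 // => i; rewrite expn_gt0 cardfs_gt0 L_neq_fset0. Qed.

Lemma nonzero_rows_eq r m (A : 'M[F]_(m, ex r)) : (k <= r)%N ->
    (ex r.-1 * K = (r.-1 + delta) ^_ k * Lam)%N -> admissible kappa L r A ->
  nb_nonzero_rows A = (r + delta)%N.
Proof.
move=> le_kr ex_pred adA; have [_ A_LK A_inj] := adA.
have r_gt0 : (0 < r)%N by apply: leq_trans le_kr.
have eq_r : (r + delta = (r.-1 + delta).+1)%N by rewrite -addSn prednK.
have ratio := nb_nonzero_rows_bound L_neq0 L_disjoint adA.
have upper := nonzero_rows_bound L_neq0 L_disjoint A_LK A_inj.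
have lower := ex_ge r; rewrite eq_r in lower *.
apply: nonzero_rows_arith k_gt0 _ Lam_gt0 ratio ex_pred lower upper.
by rewrite -eq_r (leq_trans le_kr) ?leq_addr.
Qed.

(** Equality at one rank fixes the number of nonzero rows at the next, and this number gives
    equality there. *)
Lemma ex_eq_propagate r0 r : (k <= r0)%N -> (r0 <= r)%N ->
    (ex r0 * K = (r0 + delta) ^_ k * Lam)%N ->
  (ex r * K = (r + delta) ^_ k * Lam)%N.
Proof.
move=> le_kr0 /subnK <- ex_r0; elim: (r - r0)%N => // w ex_w.
have [m [A adA]] := ex_admissible kappa L (w.+1 + r0).
apply: (ex_attained_rows adA); rewrite (nonzero_rows_eq _ _ adA) //.
by rewrite addSn; lia.
Qed.

Let n0 := (2 ^ k * K * k).+1.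
Let t := n0.*2.*2.+2.
Let W := (2 ^ k * K)%N.
Let c := (k ^ 2 * t ^ 2)%N.

(** At the rank supplied by [window_arith], growth excludes the second alternative of
    [rank_trichotomy] and [ex_ge] the third; the equality then propagates up to r. *)
Lemma ex_eq_eventually r : (4 * n0 + 2 * k + W + t + W * c + W < r)%N ->
  (ex r * K = (r + delta) ^_ k * Lam)%N.
Proof.
(* The final 1 makes the inequality W c < R strict; the last W of the hypothesis keeps the whole
   window below r. *)
set R := (4 * n0 + 2 * k + W + t + W * c + 1)%N => lt_r.
have lower r' : (r' ^_ k * Lam <= ex r' * K)%N.
  by apply: leq_trans (ex_ge r'); rewrite leq_mul2r leq_ffact ?orbT ?leq_addr.
have [||r1 /andP[lt_R le_R] growth] :=
  @window_arith ex k K Lam t c R k_gt0 K_gt0 Lam_gt0 _ _ lower ex_le.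
- by rewrite /R -/W; lia.
- by rewrite /R -/W; lia.
rewrite -/W in le_R.
apply: (@ex_eq_propagate r1); [by rewrite /R in lt_R; lia | by rewrite /R in le_R; lia |].
have [m [A adA]] := ex_admissible kappa L r1.
have [|le_rows|no_growth|[V le_V le_n]] :=
    rank_trichotomy L_neq0 L_disjoint L_neq_fset0 kappa_gt0 k_gt0 adA (n0 := n0).
- by rewrite /R in lt_R; lia.
- exact: (ex_attained_rows adA).
- by move: growth; rewrite /c -[(k ^ 2 * t ^ 2 * _)%N]mulnA ltnNge no_growth.
- have le_r1 : (4 * n0 + 2 * k + 1 <= r1)%N by rewrite /R in lt_R; lia.
  have := few_violators_arith k_gt0 K_gt0 Lam_gt0 le_r1 le_V le_n.
  by rewrite ltnNge lower.
Qed.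

End Conclusion.

Theorem theorem3 (s : nat) (kappa : 'I_s -> nat)
    (kappa_gt0 : forall i, (0 < kappa i)%N) :
  exists R_kappa : nat,
  forall (F : fieldType) (L : 'I_s -> {fset F}),
    (forall i, 0 \notin L i) ->
    (forall i j, i != j -> [disjoint L i & L j]%fset) ->
  forall r : nat, (R_kappa <= r)%N ->
    exLK L kappa r =
      (if `[< zero_sum_singletons L kappa >] then multinom r.+1 kappa
       else (card_pow L kappa * multinom r kappa)%N)
    /\
    ((0 < s)%N -> (forall i, L i != fset0) ->
     forall (m n : nat) (A : 'M[F]_(m, n)),
       (\rank A <= r)%N ->
       (forall j, LK_vector L kappa (col j A)) ->
       injective (fun j => col j A) ->
       n = exLK L kappa r ->
       nb_nonzero_rows A =
         (if `[< zero_sum_singletons L kappa >] then r.+1 else r)).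
Proof.
pose k := (\sum_i kappa i)%N; pose K := (\prod_i (kappa i)`!)%N.
pose n0 := (2 ^ k * K * k).+1; pose t := n0.*2.*2.+2.
pose W := (2 ^ k * K)%N; pose c := (k ^ 2 * t ^ 2)%N.
pose R := (4 * n0 + 2 * k + W + t + W * c + W)%N.
(* The row count at r uses equality at r - 1, hence one more than the bound needed for the value. *)
exists R.+2 => F L L_neq0 L_disjoint r le_Rr.
have [lt_Rr1 lt_Rr] : (R < r.-1)%N /\ (R < r)%N by move: (R) le_Rr => R' ?; lia.
have K_gt0 : (0 < K)%N by rewrite prodn_gt0 // => i; apply: fact_gt0.
have k_gt0 : (0 < s)%N -> (0 < k)%N.
  by move=> s_gt0; rewrite /k (bigD1 (Ordinal s_gt0)) //= addn_gt0 kappa_gt0.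
pose delta := `[< zero_sum_singletons L kappa >].
split; last first.
  move=> s_gt0 L_neq_fset0 m n A rA A_LK A_inj def_n.
  rewrite def_n in A rA A_LK A_inj *.
  rewrite (nonzero_rows_eq L_neq0 L_disjoint L_neq_fset0 (k_gt0 s_gt0) (r := r)) //.
  - by case: asboolP; rewrite ?addn1 ?addn0.
  - by apply: leq_trans le_Rr; rewrite -/k /R; lia.
  - exact: (ex_eq_eventually L_neq0 L_disjoint L_neq_fset0 kappa_gt0 (k_gt0 s_gt0) lt_Rr1).
have ex_eq : (exLK L kappa r * K = (r + delta) ^_ k * card_pow L kappa)%N.
  (* With some [L i] empty, Lam = 0 and there are no columns. *)
  have [[i /eqP Li0]|L_neq_fset0] := pselect (exists i, L i == fset0).
    have Lam0 : card_pow L kappa = 0%N.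
      by rewrite /card_pow (bigD1 i) //= Li0 cardfs0 exp0n ?kappa_gt0.
    have [m [A [_ A_LK A_inj]]] := ex_admissible kappa L r.
    apply/eqP; rewrite Lam0 muln0 -leqn0 -(muln0 (nb_nonzero_rows A ^_ k)) -Lam0.
    exact: nonzero_rows_bound.
  (* For s = 0 one has k = 0, and the general upper and lower bounds coincide. *)
  have [s0|s_gt0] := posnP s.
    have [m [A [_ A_LK A_inj]]] := ex_admissible kappa L r.
    have k0 : k = 0%N by rewrite /k big1 // => i _; have := ltn_ord i; lia.
    apply/eqP; rewrite eqn_leq ex_ge // andbT.
    have := nonzero_rows_bound L_neq0 L_disjoint A_LK A_inj.
    by rewrite -/k k0 !ffactn0.
  apply: (ex_eq_eventually L_neq0 L_disjoint _ kappa_gt0 (k_gt0 s_gt0) lt_Rr).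
  by move=> i; apply/negP => Li0; apply: L_neq_fset0; exists i.
apply/eqP; rewrite -(eqn_pmul2r K_gt0) ex_eq /delta; apply/eqP.
case: asboolP => [[ell [ellP _]]|_]; last by rewrite addn0 mulnC -mulnA multinom_ffact.
rewrite addn1 multinom_ffact /card_pow big1 ?muln1 // => i _.
by rewrite ellP cardfs1 exp1n.
Qed.
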